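(* There exist two bounded bilinear operators $L: H_1\times \mathrm{BMO}\to \mathcal{BV}$ and $G: H_1\times\mathrm{BMO}\to H_{\log}$ such that, for every $(f,g)\in H_1\times \mathrm{BMO}$, the process $f\cdot g:=(f_ng_n)_{n\in\mathbb Z_+}$ can be written as $$f\cdot g=L(f,g)+G(f,g).$$ Moreover, for any $n\in\mathbb Z_+$, $$L(f,g)_n:=\sum_{k=0}^n d_k(f)\,d_k(g).$$
   Context: $\mathbb Z_+=\{0,1,2,\dots\}$. $(\Omega,\mathcal F,\mathbb P)$ is a complete probability space and $(\mathcal F_n)_{n\in\mathbb Z_+}$ is an increasing sequence of sub-$\sigma$-algebras of $\mathcal F$ with $\mathcal F=\sigma(\bigcup_n\mathcal F_n)$ and $\mathcal F_0=\{\emptyset,\Omega\}$. $\mathbb E$ is the expectation and $\mathbb E_n$ the conditional expectation with respect to $\mathcal F_n$. All martingales are with respect to $(\mathcal F_n)$. For an adapted process $h=(h_n)_{n\in\mathbb Z_+}$, $d_0(h):=h_0$ and $d_n(h):=h_n-h_{n-1}$ for $n\ge 1$ (convention $h_{-1}:=0$). For a martingale $f$, $S(f):=(\sum_{n\in\mathbb Z_+}|d_n f|^2)^{1/2}$. $H_1$: martingales $f$ with $\|f\|_{H_1}:=\|S(f)\|_{L^1}<\infty$. $L^{\log}$: measurable functions $f$ with $\|f\|_{L^{\log}}:=\inf\{\lambda>0:\int_\Omega \frac{|f|/\lambda}{\log(e+|f|/\lambda)}\,d\mathbb P\le 1\}<\infty$. $H_{\log}$: martingales $f$ with $\|f\|_{H_{\log}}:=\|S(f)\|_{L^{\log}}<\infty$.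 $\mathrm{BMO}$: for $p\in[1,\infty)$, $\mathrm{BMO}_p$ is the set of martingales $f\in L^p$ with $\|f\|_{\mathrm{BMO}_p}:=\sup_{n\in\mathbb Z_+}\|\mathbb E_n(|f-f_{n-1}|^p)\|_{L^\infty}^{1/p}<\infty$ (with $f_{-1}=0$, and $f$ identified with its limit $f_\infty$); all these spaces coincide with equivalent norms, and $\mathrm{BMO}$ denotes any of them. $\mathcal{BV}$: adapted sequences of random variables $h=(h_n)_{n\in\mathbb Z_+}$ with $\mathbb E(\sum_{n=1}^\infty|h_n-h_{n-1}|)<\infty$, with norm $\mathbb E(|h_0|+\sum_{n=1}^\infty|h_n-h_{n-1}|)$. A bilinear operator $B:X\times Y\to Z$ is bounded if $\|B(f,g)\|_Z\le C\|f\|_X\|g\|_Y$ with $C$ independent of $f,g$. *)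

(* Defs.v *)
(* MathComp-Analysis *)
From HB Require Import structures.
From mathcomp Require Import all_boot all_order all_algebra.
From mathcomp Require Import all_classical all_reals all_analysis.

Set Implicit Arguments.
Unset Strict Implicit.
Unset Printing Implicit Defensive.
Import Order.TTheory GRing.Theory Num.Theory.
Import numFieldNormedType.Exports.

Local Open Scope classical_set_scope.
Local Open Scope ring_scope.

Section martingale_spaces.
Context {d : measure_display} {T : measurableType d} {R : realType}.
Variables (P : probability T R) (F : nat -> set (set T)).

Definition process := nat -> T -> R.

Implicit Types (G : set (set T)) (X Y : T -> R) (f g h : process).

Definition filtration :=
  [/\ forall n, sigma_algebra [set: T] (F n),
      forall n, F n `<=` d.-measurable &
      forall m n, (m <= n)%N -> F m `<=` F n].

Definition adapted h :=
  forall n, measurable_fun [set: g_sigma_algebraType (F n)] (h n).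

(* Y is a version of the conditional expectation of X with respect to the
   sigma-algebra G. *)
Definition is_cexp G X Y :=
  [/\ measurable_fun [set: g_sigma_algebraType G] Y,
      P.-integrable [set: T] (EFin \o Y) &
      forall A, G A -> (\int[P]_(x in A) (Y x)%:E = \int[P]_(x in A) (X x)%:E)%E].

(* A chosen version, unique up to a null set; meaningful only for an
   integrable X, the default value being 0. *)
Definition cexp G X : T -> R := xget (cst 0) [set Y | is_cexp G X Y].

Definition martingale f :=
  [/\ adapted f,
      forall n, P.-integrable [set: T] (EFin \o f n) &
      forall n, is_cexp (F n) (f n.+1) (f n)].

(* [lag h n] is h_{n-1}, with h_{-1} = 0. *)
Definition lag h n : T -> R := if n is m.+1 then h m else cst 0.

Definition mdiff n h : T -> R := fun x => h n x - lag h n x.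

(* Extended-real valued: the series may diverge at some points. *)
Definition sqfun f : T -> \bar R :=
  fun x => ((\sum_(0 <= n <oo) (`|mdiff n f x| ^+ 2)%:E) `^ 2^-1)%E.

Definition H1_norm f : \bar R := 'N[P]_1 [sqfun f]%E.

Definition H1 : set process := [set f | martingale f /\ (H1_norm f < +oo)%E].

(* t / log (e + t) on [0, +oo], with its limit +oo at +oo; it is only applied
   to nonnegative arguments. *)
Definition Philog (t : \bar R) : \bar R :=
  match t with
  | r%:E => (r / ln (expR 1 + r))%:E
  | +oo => +oo
  | -oo => 0
  end%E.

(* Luxemburg norm, +oo if no l is admissible. *)
Definition Llog_norm (X : T -> \bar R) : \bar R :=
  ereal_inf [set l%:E | l in
    [set l : R | 0 < l /\
                 (\int[P]_x Philog (`|X x| * (l^-1)%:E) <= 1)%E]].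

Definition Hlog_norm f : \bar R := Llog_norm (sqfun f).

Definition Hlog : set process :=
  [set f | martingale f /\ (Hlog_norm f < +oo)%E].

(* The pointwise limit of f; an arbitrary constant where f diverges. *)
Definition flim f : T -> R := fun x => limn (fun n => f n x).

(* A martingale in L^p is identified with its almost sure limit: the limit is
   in L^p and closes the martingale. *)
Definition Lp_martingale (p : R) f :=
  [/\ martingale f,
      {ae P, forall x, (fun n => f n x) @ \oo --> flim f x},
      flim f \in Lfun P p%:E &
      forall n, is_cexp (F n) (flim f) (f n)].

Definition BMO_norm (p : R) f : \bar R :=
  ereal_sup (range (fun n =>
    ('N[P]_+oo [EFin \o
       cexp (F n) (fun x => (`|flim f x - lag f n x| `^ p)%R)] `^ p^-1)%E)).

Definition BMO (p : R) : set process :=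
  [set f | Lp_martingale p f /\ (BMO_norm p f < +oo)%E].

Definition total_var h : T -> \bar R :=
  fun x => (\sum_(1 <= n <oo) `|h n x - h n.-1 x|%:E)%E.

Definition BV_norm h : \bar R :=
  (\int[P]_x (`|h 0%N x|%:E + total_var h x))%E.

Definition BV : set process :=
  [set h | adapted h /\ (\int[P]_x total_var h x < +oo)%E].

End martingale_spaces.

Arguments process {d} T R.

(* B maps X x Y to Z, is bilinear there, and is bounded for the given norms.
   Processes are honest functions, so that bilinearity is an identity between
   functions; with boundedness it implies that B respects almost sure
   equality. *)
Definition bounded_bilinear {d : measure_display} {T : measurableType d}
    {R : realType} (X Y Z : set (process T R))
    (normX normY normZ : process T R -> \bar R)
    (B : process T R -> process T R -> process T R) :=
  [/\ forall f g, X f -> Y g -> Z (B f g),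
      forall (a : R) f f' g, X f -> X f' -> Y g ->
        B (fun n x => a * f n x + f' n x) g =
        (fun n x => a * B f g n x + B f' g n x),
      forall (a : R) f g g', X f -> Y g -> Y g' ->
        B f (fun n x => a * g n x + g' n x) =
        (fun n x => a * B f g n x + B f g' n x) &
      exists C : R, forall f g, X f -> Y g ->
        (normZ (B f g) <= C%:E * normX f * normY g)%E].

(* Main.v *)
Require Import Defs.
From HB Require Import structures.
From mathcomp Require Import all_boot all_order all_algebra.
From mathcomp Require Import all_classical all_reals all_analysis.
From mathcomp Require Import measurable_realfun ess_sup_inf ring lra.

(* Write d_n h = mdiff n h. Then f g = L + G, where d_n L = d_n f d_n g and
   d_n G = f_{n-1} d_n g + g_{n-1} d_n f.

   The bound on L is Fefferman's duality inequality
   E sum |d_k f| |d_k g| <= C E S(f) |g|_BMO.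

   In G, the square function of the first paraproduct is controlled by f^* and
   sum f^*_{k-1} |d_k g|^2, which are integrable by Davis' inequality
   E f^* <= C E S(f) and the BMO_2 property of g; that of the second is at most
   g^* S(f), with g^* exponentially integrable by the John-Nirenberg inequality,
   and L^exp . L^1 is contained in L^log.

   Davis' inequality is obtained from a pathwise inequality of Beiglboeck and
   Siorpaes, so that only the vanishing of expectations of martingale transforms is
   used. The John-Nirenberg inequality starts from the BMO_1 bound, which every
   BMO_p bound implies. *)

Set Implicit Arguments.
Unset Strict Implicit.
Unset Printing Implicit Defensive.
Import Order.TTheory GRing.Theory Num.Theory.
Import numFieldNormedType.Exports.

Local Open Scope classical_set_scope.
Local Open Scope ring_scope.

(** Conditional bounds are kept in integrated form: a bound given [F n] is an inequality between
    integrals over every set of [F n], and measurable weights are inserted afterwards by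
    approximation with simple functions.

    BMO measures the distance to g_{n-1} and not to g_n, so it also bounds the jump at time n almost
    surely. This makes f_{n-1} d_n g integrable although f is only in L^1, and it lets the
    John-Nirenberg iteration restart just before an exit.

    The martingale inequalities are proved up to a finite time, with constants independent of that
    time, and limits are taken at the end. The norms enter through reals a and b strictly above
    them, hence positive, so that division is harmless even when a norm vanishes; a and b are
    finally lowered to the norms. The constants are rounded up to powers of two and do not depend on
    p. *)

Section sub_sigma_algebra.
Context {d : measure_display} {T : measurableType d} {R : realType}.
Variables (P : {measure set T -> \bar R}) (G : set (set T)).
Hypotheses (sG : sigma_algebra [set: T] G) (GT : G `<=` d.-measurable).

Lemma sub_measurable (A : set T) : G.-sigma.-measurable A -> G A.
Proof. by rewrite measurable_g_measurableTypeE. Qed.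

Lemma measurable_sub (A : set T) : G A -> G.-sigma.-measurable A.
Proof. by rewrite measurable_g_measurableTypeE. Qed.

Lemma measurable_fun_sub {d'} {S : measurableType d'} (X : T -> S) :
  measurable_fun [set: g_sigma_algebraType G] X -> measurable_fun [set: T] X.
Proof.
by move=> mX _ A mA; apply: GT; apply: sub_measurable; exact: mX.
Qed.

Local Open Scope ereal_scope.
Import HBNNSimple.

(** The level sets of a [G]-measurable simple function lie in [G], so the hypothesis applies to each
    of them, and monotone convergence passes to [X]. This replaces pulling a weight out of a
    conditional expectation. *)
Lemma le_integral_weight (Z1 Z2 X : T -> R) :
  measurable_fun [set: T] Z1 -> measurable_fun [set: T] Z2 ->
  (forall x, 0 <= Z1 x)%R -> (forall x, 0 <= Z2 x)%R ->
  (forall A, G A ->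
    \int[P]_(x in A) (Z1 x)%:E <= \int[P]_(x in A) (Z2 x)%:E) ->
  measurable_fun [set: g_sigma_algebraType G] X -> (forall x, 0 <= X x)%R ->
  \int[P]_x (X x * Z1 x)%:E <= \int[P]_x (X x * Z2 x)%:E.
Proof.
move=> mZ1 mZ2 Z10 Z20 Z12 mX X0.
have mEX : measurable_fun [set: g_sigma_algebraType G] (EFin \o X).
  exact/measurable_EFinP.
pose phi := nnsfun_approx measurableT mEX.
have mphi n : measurable_fun [set: T] (phi n : T -> R).
  by apply: measurable_fun_sub; exact: measurable_funP.
have cphi x : EFin \o phi^~ x @ \oo --> (X x)%:E.
  by apply: (@cvg_nnsfun_approx _ _ _ _ measurableT _ mEX) => // y _; rewrite lee_fin.
have simpl (Z : T -> R) n : measurable_fun [set: T] Z -> (forall x, 0 <= Z x)%R ->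
    \int[P]_x (phi n x * Z x)%:E =
    \sum_(r \in range (phi n))
      (r%:E * \int[P]_(x in phi n @^-1` [set r]) (Z x)%:E).
  move=> mZ Z0.
  have mpre r : d.-measurable (phi n @^-1` [set r] : set T).
    by apply: GT; apply: sub_measurable; exact: measurable_sfunP.
  transitivity (\int[P]_x \sum_(r \in range (phi n))
      (r%:E * ((EFin \o Z) \_ (phi n @^-1` [set r])) x)).
    apply: eq_integral => x _.
    rewrite (fsbigD1 (phi n x))//=; last by exists x.
    rewrite /patch mem_set//= fsbig1 ?adde0//.
    by move=> r [_ /= rx]; rewrite memNset ?mule0//= => /esym.
  rewrite ge0_integral_fsum//=.
  - apply: eq_fsbigr => r /set_mem[y _ <-].
    rewrite [in RHS]integral_mkcond ge0_integralZl//=.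
    + apply: (measurable_restrictT _ (mpre _)).1.
      by apply/measurable_funTS/measurable_EFinP.
    + by move=> x _; apply: erestrict_ge0 => z _; rewrite lee_fin.
    + by rewrite lee_fin.
  - move=> r; apply: measurable_funeM.
    apply: (measurable_restrictT _ (mpre _)).1.
    by apply/measurable_funTS/measurable_EFinP.
  - move=> r x _; have [->|rx] := eqVneq r (phi n x).
      by rewrite mule_ge0 ?lee_fin//; apply: erestrict_ge0 => z _; rewrite lee_fin.
    by rewrite /patch memNset ?mule0//= => /esym/eqP; apply/negP.
have cvgZ (Z : T -> R) : measurable_fun [set: T] Z -> (forall x, 0 <= Z x)%R ->
    (fun n => \int[P]_x (phi n x * Z x)%:E) @ \oo --> \int[P]_x (X x * Z x)%:E.
  move=> mZ Z0.
  have := @cvg_monotone_convergence _ _ _ P _ measurableT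
    (fun n x => (phi n x * Z x)%:E).
  rewrite (_ : (fun x => limn _) = (fun x => (X x * Z x)%:E)); last first.
    apply/funext => x; apply/cvg_lim => //=; rewrite EFinM.
    under eq_fun do rewrite EFinM.
    by apply: cvgeZr => //; exact: cphi.
  apply.
  - by move=> n; apply/measurable_EFinP/measurable_funM.
  - by move=> n x _; rewrite lee_fin mulr_ge0.
  - move=> x _ m n mn; rewrite lee_fin ler_wpM2r//.
    by have /lefP := nd_nnsfun_approx measurableT mEX mn; exact.
rewrite -(cvg_lim _ (cvgZ _ mZ1 Z10))// -(cvg_lim _ (cvgZ _ mZ2 Z20))//.
apply: lee_lim.
- by apply/cvg_ex; eexists; exact: cvgZ.
- by apply/cvg_ex; eexists; exact: cvgZ.
- apply: nearW => n; rewrite !simpl//; apply: lee_fsum => //.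
  move=> r [x _ <-]; rewrite lee_wpmul2l ?lee_fin//; apply: Z12.
  by apply: sub_measurable; exact: measurable_sfunP.
Qed.

(** [|Y| + Y] and [|Y|] are nonnegative and have equal integrals over the sets of [G], so the
    comparison above, used in both directions, settles nonnegative weights. A signed [X] is reached
    through the weights [|X|] and [|X| + X]. *)
Lemma integral_weight0 (Y X : T -> R) :
  P.-integrable [set: T] (EFin \o Y) ->
  (forall A, G A -> \int[P]_(x in A) (Y x)%:E = 0) ->
  measurable_fun [set: g_sigma_algebraType G] X ->
  P.-integrable [set: T] (fun x => (X x * Y x)%:E) ->
  \int[P]_x (X x * Y x)%:E = 0.
Proof.
move=> iY Y0 mX iXY.
have mY : measurable_fun [set: T] Y by apply/measurable_EFinP; exact: measurable_int iY.
have half (X' : T -> R) : measurable_fun [set: g_sigma_algebraType G] X' ->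
    (forall x, 0 <= X' x)%R ->
    P.-integrable [set: T] (fun x => (X' x * Y x)%:E) ->
    \int[P]_x (X' x * Y x)%:E = 0.
  move=> mX' X'0 iX'Y.
  have iX'aY : P.-integrable [set: T] (fun x => (X' x * `|Y x|)%:E).
    apply: le_integrable iX'Y => //.
      apply/measurable_EFinP/measurable_funM; first exact: measurable_fun_sub.
      exact: measurableT_comp.
    by move=> x _; rewrite !abse_EFin lee_fin !normrM normr_id.
  have mZ : measurable_fun [set: T] (fun x => `|Y x| + Y x)%R.
    by apply: measurable_funD => //; exact: measurableT_comp.
  have Z0 x : (0 <= `|Y x| + Y x)%R by rewrite -lerBlDr sub0r -normrN ler_norm.
  have YA A : G A ->
      \int[P]_(x in A) (`|Y x| + Y x)%:E = \int[P]_(x in A) (`|Y x|)%:E.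
    move=> GA; have iYA := integrableS measurableT (GT GA) (@subsetT _ A) iY.
    under eq_integral do rewrite EFinD.
    rewrite integralD ?Y0 ?adde0//; first exact: GT.
    exact: (integrable_abse iYA).
  have : \int[P]_x (X' x * (`|Y x| + Y x))%:E = \int[P]_x (X' x * `|Y x|)%:E.
    apply/eqP; rewrite eq_le !le_integral_weight//.
    - exact: measurableT_comp.
    - by move=> A GA; rewrite YA.
    - exact: measurableT_comp.
    - by move=> A GA; rewrite YA.
  under eq_integral do rewrite mulrDr EFinD.
  rewrite integralD// addeC.
  move=> /(congr1 (fun z => z - \int[P]_x (X' x * `|Y x|)%:E)).
  by rewrite addeK ?subee// integrable_fin_num.
have mX1 := measurable_fun_sub mX.
have iaXY : P.-integrable [set: T] (fun x => (`|X x| * Y x)%:E).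
  apply: le_integrable iXY => //.
    by apply/measurable_EFinP/measurable_funM => //; exact: measurableT_comp.
  by move=> x _; rewrite !abse_EFin lee_fin !normrM normr_id.
have iXXY : P.-integrable [set: T] (fun x => ((`|X x| + X x) * Y x)%:E).
  under eq_fun do rewrite mulrDl EFinD.
  exact: integrableD.
have := half _ _ _ iXXY.
under eq_integral do rewrite mulrDl EFinD.
rewrite integralD// (half _ _ _ iaXY)// ?add0e; last exact: measurableT_comp.
apply.
  by apply: measurable_funD => //; exact: measurableT_comp.
by move=> x; rewrite -lerBlDr sub0r -normrN ler_norm.
Qed.

End sub_sigma_algebra.

(** * Existence of conditional expectations *)

Section cexp_existence.
Context {d : measure_display} {T : measurableType d} {R : realType}.
Variables (P : probability T R) (G : set (set T)).
Hypotheses (sG : sigma_algebra [set: T] G) (GT : G `<=` d.-measurable).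
Local Open Scope ereal_scope.

(** The charge of density [X] and the measure [P] are both transported along the identity onto the
    coarser space carrying [G]; a Radon-Nikodym derivative there is [G]-measurable by
    construction. *)
Lemma cexpP (X : T -> R) : P.-integrable [set: T] (EFin \o X) ->
  is_cexp P G X (cexp P G X).
Proof.
move=> iX; rewrite /cexp; case: xgetP => [Y _ //|noY]; exfalso.
pose i : T -> g_sigma_algebraType G := fun x => x.
have mi : measurable_fun [set: T] i.
  by move=> _ A mA; rewrite setTI; apply: GT; exact: sub_measurable.
pose I : {mfun T >-> g_sigma_algebraType G} := HB.pack i (isMeasurableFun.Build _ _ _ _ i mi).
have dom : pushforward (induced_charge iX) I `<< distribution P I.
  apply/null_content_dominatesP => A mA.
  rewrite /distribution /pushforward /= => PA0.
  have mA' : d.-measurable (I @^-1` A) by apply: GT; exact: sub_measurable.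
  apply: null_set_integral => //.
  by apply: measurable_funTS; exact: measurable_int iX.
have [Y [fRN iRN RNE]] : exists Y : g_sigma_algebraType G -> \bar R,
    [/\ forall x, Y x \is a fin_num,
        (distribution P I).-integrable [set: g_sigma_algebraType G] Y &
        forall A : set (g_sigma_algebraType G), measurable A ->
          \int[P]_(x in A) (X x)%:E =
                                 \int[distribution P I]_(x in A) Y x].
  eexists; split.
  - by move=> x; apply: (@Radon_Nikodym_fin_num _ _ _ _ _ x dom).
  - exact: (@Radon_Nikodym_integrable _ _ _ _ _ dom).
  - by move=> A mA; rewrite -(@Radon_Nikodym_integral _ _ _ _ _ A dom mA).
have mY : measurable_fun [set: g_sigma_algebraType G] Y.
  exact: measurable_int iRN.
apply: (noY (fine \o Y)).
have fY : EFin \o (fine \o Y) = Y by apply/funext => x; rewrite /= fineK.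
have iY : P.-integrable [set: T] Y.
  apply/integrableP; split; first exact: measurable_fun_sub mY.
  move/integrableP : iRN => [_].
  rewrite ge0_integral_pushforward//.
  exact: measurableT_comp.
split.
- by apply/measurable_EFinP; rewrite fY.
- by rewrite fY.
- move=> A GA; have mA := measurable_sub sG GA.
  under eq_integral do rewrite /= fineK//.
  rewrite (RNE _ mA) integral_pushforward//.
  exact: (integrableS measurableT (GT GA) (@subsetT _ A) iY).
Qed.

End cexp_existence.

(** * The one-step inequality behind Davis' inequality *)

Section davis_step.
Context {R : realType}.
Implicit Types x y q r a b m : R.

(* Here [a = sqrt (q^2 + m^2)], with [m] the running maximum of [`|x|] and [q] the square
   function. The derivative in [x] is [x / a], the one in [m] vanishes at [m = `|x|], and
   [12 * q] absorbs the second-order terms. *)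
Definition davis_potential x a q : R := (x ^+ 2 / a + a + q ^+ 2 / a) / 2 - 12 * q.

Lemma davis_step x y q r a b m m' :
  0 <= q -> 0 <= r -> 0 <= a -> 0 <= b -> `|x| <= m -> m' = Num.max m `|y| ->
  a ^+ 2 = q ^+ 2 + m ^+ 2 -> r ^+ 2 = q ^+ 2 + (y - x) ^+ 2 ->
  b ^+ 2 = r ^+ 2 + m' ^+ 2 ->
  davis_potential y b r - davis_potential x a q <= x / a * (y - x).
Proof.
move=> q0 r0 a0 b0 xm m'E aE rE bE; rewrite /davis_potential.
have m0 : 0 <= m := le_trans (normr_ge0 _) xm.
have mm' : m <= m' by rewrite m'E le_max lexx.
have ym' : `|y| <= m' by rewrite m'E le_max lexx orbT.
have qr : q <= r by rewrite -(@ler_pXn2r _ 2)// rE lerDl sqr_ge0.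
have qa : q <= a by rewrite -(@ler_pXn2r _ 2)// aE lerDl sqr_ge0.
have ma : m <= a by rewrite -(@ler_pXn2r _ 2)// aE lerDr sqr_ge0.
have rb : r <= b by rewrite -(@ler_pXn2r _ 2)// bE lerDl sqr_ge0.
have mb : m' <= b.
  by rewrite -(@ler_pXn2r _ 2)// ?bE ?lerDr ?sqr_ge0// nnegrE (le_trans m0).
have ab : a <= b.
  rewrite -(@ler_pXn2r _ 2)// aE bE lerD// ler_pXn2r//.
  by rewrite nnegrE (le_trans m0).
pose D := `|y - x|.
have DE : D ^+ 2 = (y - x) ^+ 2 by rewrite real_normK ?num_real.
have D0 : 0 <= D by exact: normr_ge0.
have yD : `|y| <= m + D.
  by rewrite (le_trans _ (lerD xm (lexx D)))// -{1}(subrKC x y) ler_normD.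
have rqD : r <= q + D by rewrite -(@ler_pXn2r _ 2)// ?nnegrE; nra.
have m'D : m' <= m + D by rewrite m'E ge_max yD lerDl D0.
have baD : b <= a + 2 * D by rewrite -(@ler_pXn2r _ 2)// ?nnegrE; nra.
have sqK (z c : R) : 0 <= c -> `|z| <= c -> z ^+ 2 / c <= `|z|.
  move=> c0 zc; have [->|cn0] := eqVneq c 0; first by rewrite invr0 mulr0.
  have cp : 0 < c by rewrite lt_def cn0.
  by rewrite ler_pdivrMr// -[z ^+ 2]real_normK ?num_real// expr2 ler_wpM2l.
(* Large jump: since [m] and [q] are at most [a < D], the potential without its [12 * q] term grows
   by at most [3 * D], and the right-hand side is at least [- D]. As [r + q <= 3 * D] gives
   [D <= 3 * (r - q)], the total [4 * D] is what the coefficient 12 pays for. *)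
have [Da|aD] := leP D a; last first.
  have rqD3 : D <= 3 * (r - q).
    have : (r - q) * (r + q) = D ^+ 2 by rewrite -subr_sqr rE DE; ring.
    nra.
  have h1 : y ^+ 2 / b <= `|y| by apply: sqK => //; exact: le_trans mb.
  have h2 : r ^+ 2 / b <= r.
    by rewrite -{2}(ger0_norm r0); apply: sqK; rewrite ?ger0_norm.
  have h3 : 0 <= x ^+ 2 / a by rewrite mulr_ge0 ?sqr_ge0 ?invr_ge0.
  have h4 : 0 <= q ^+ 2 / a by rewrite mulr_ge0 ?sqr_ge0 ?invr_ge0.
  have h5 : - D <= x / a * (y - x).
    rewrite lerNl; apply: le_trans (ler_norm _) _; rewrite normrN normrM.
    rewrite ger_pMl// ?(le_lt_trans a0)// normrM normfV (ger0_norm a0).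
    have [->|an0] := eqVneq a 0; first by rewrite invr0 mulr0.
    by rewrite ler_pdivrMr ?lt_def ?an0// mul1r (le_trans xm).
  lra.
have [a00|an0] := eqVneq a 0.
  have m00 : m = 0 by lra.
  have q00 : q = 0 by lra.
  have D00 : D = 0 by lra.
  have r00 : r = 0 by lra.
  have b00 : b = 0 by lra.
  by rewrite a00 b00 q00 r00 invr0 !mulr0 mul0r !addr0 !mul0r subrr.
have ap : 0 < a by rewrite lt_def an0.
have bp : 0 < b by exact: lt_le_trans ab.
have Dr : D ^+ 2 / a <= 3 * (r - q).
  rewrite ler_pdivrMr//.
  have : (r - q) * (r + q) = D ^+ 2 by rewrite -subr_sqr rE DE; ring.
  nra.
(* Small jump: this is twice the claim without the [12 * q] terms, and its error [3 * (D ^+ 2 / a)]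
   is at most [9 * (r - q)]. *)
suff : y ^+ 2 / b - x ^+ 2 / a - 2 * (x / a * (y - x)) + (b - a) +
    (r ^+ 2 / b - q ^+ 2 / a) <= 3 * (D ^+ 2 / a) by lra.
have -> : y ^+ 2 / b - x ^+ 2 / a - 2 * (x / a * (y - x)) =
   D ^+ 2 / a - y ^+ 2 * (b - a) / (a * b).
  rewrite DE; field.
  by rewrite !gt_eqF.
have Da0 : 0 <= D ^+ 2 / a by rewrite divr_ge0 ?sqr_ge0.
have [ym|my] := leP `|y| m.
  have m'm : m' = m by rewrite m'E max_l.
  have h1 : b - a <= D ^+ 2 / a.
    rewrite ler_pdivlMr//.
    have : (b - a) * (b + a) = D ^+ 2 by rewrite -subr_sqr bE aE rE DE m'm; ring.
    nra.
  have h2 : r ^+ 2 / b - q ^+ 2 / a <= D ^+ 2 / a.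
    have : r ^+ 2 / b <= r ^+ 2 / a.
      by rewrite ler_wpM2l ?sqr_ge0// lef_pV2.
    have -> : D ^+ 2 / a = r ^+ 2 / a - q ^+ 2 / a by rewrite rE DE; ring.
    lra.
  have h3 : 0 <= y ^+ 2 * (b - a) / (a * b).
    by apply: divr_ge0; apply: mulr_ge0; rewrite ?sqr_ge0 ?subr_ge0.
  lra.
(* New maximum: with [m' = |y|] the terms of first order in [b - a] cancel, and an exact identity
   leaves only [D ^+ 2 / a] and a negative square. *)
have bE' : b ^+ 2 = r ^+ 2 + y ^+ 2.
  by rewrite bE m'E max_r ?ltW// real_normK ?num_real.
have -> : D ^+ 2 / a - y ^+ 2 * (b - a) / (a * b) + (b - a) +
    (r ^+ 2 / b - q ^+ 2 / a) = 2 * (D ^+ 2 / a) - (b - a) ^+ 2 / a.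
  have -> : q ^+ 2 = b ^+ 2 - y ^+ 2 - D ^+ 2 by rewrite bE' rE DE; ring.
  have -> : r ^+ 2 = b ^+ 2 - y ^+ 2 by rewrite bE'; ring.
  by field; rewrite !gt_eqF.
have : 0 <= (b - a) ^+ 2 / a by rewrite divr_ge0 ?sqr_ge0.
lra.
Qed.

End davis_step.

(** * Pathwise inequalities for the truncated square and maximal functions *)

Section pathwise.
Context {d : measure_display} {T : measurableType d} {R : realType}.
Implicit Types (f : process T R) (x : T).

Definition sqpart f n x : R := Num.sqrt (\sum_(0 <= k < n.+1) mdiff k f x ^+ 2).

Fixpoint maxpart f n x : R :=
  if n is m.+1 then Num.max (maxpart f m x) `|f n x| else `|f 0%N x|.

Lemma mdiffS n f x : mdiff n.+1 f x = f n.+1 x - f n x.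
Proof. by []. Qed.

Lemma sqpart_ge0 f n x : 0 <= sqpart f n x.
Proof. exact: sqrtr_ge0. Qed.

Lemma sqr_sqpart f n x :
  sqpart f n x ^+ 2 = \sum_(0 <= k < n.+1) mdiff k f x ^+ 2.
Proof. by rewrite sqr_sqrtr// sumr_ge0// => k _; exact: sqr_ge0. Qed.

Lemma sqr_sqpartS f n x :
  sqpart f n.+1 x ^+ 2 = sqpart f n x ^+ 2 + mdiff n.+1 f x ^+ 2.
Proof. by rewrite !sqr_sqpart big_nat_recr. Qed.

Lemma sqpart0 f x : sqpart f 0 x = `|f 0%N x|.
Proof. by rewrite /sqpart big_nat1 /mdiff subr0 sqrtr_sqr. Qed.

Lemma sqpart_nd f x : {homo sqpart f ^~ x : m n / (m <= n)%N >-> m <= n}.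
Proof.
apply: (@homo_leq _ _ (fun a b : R => a <= b)) => [//|m n p|n] /=.
  exact: le_trans.
rewrite -(@ler_pXn2r _ 2) ?nnegrE ?sqpart_ge0// sqr_sqpartS lerDl.
exact: sqr_ge0.
Qed.

Lemma maxpart0 f x : maxpart f 0 x = `|f 0%N x|.
Proof. by []. Qed.

Lemma maxpartS f n x : maxpart f n.+1 x = Num.max (maxpart f n x) `|f n.+1 x|.
Proof. by []. Qed.

Lemma maxpart_nd f x : {homo maxpart f ^~ x : m n / (m <= n)%N >-> m <= n}.
Proof.
apply: (@homo_leq _ _ (fun a b : R => a <= b)) => [//|m n p|n] /=.
  exact: le_trans.
by rewrite le_max lexx.
Qed.

Lemma le_maxpart f n x : `|f n x| <= maxpart f n x.
Proof. by case: n => [|n]; rewrite ?maxpart0// maxpartS le_max lexx orbT. Qed.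

Lemma maxpart_ge0 f n x : 0 <= maxpart f n x.
Proof. exact: le_trans (le_maxpart f n x). Qed.

(* The integrand of Beiglboeck and Siorpaes. *)
Definition davis_transform f n x : R :=
  f n x / Num.sqrt (sqpart f n x ^+ 2 + maxpart f n x ^+ 2).

Lemma davis_transform_le1 f n x : `|davis_transform f n x| <= 1.
Proof.
rewrite normrM normfV (ger0_norm (sqrtr_ge0 _)).
set s := Num.sqrt _.
have fs : `|f n x| <= s.
  rewrite -(ger0_norm (normr_ge0 _)) -sqrtr_sqr ler_wsqrtr//.
  rewrite ler_wpDl ?sqr_ge0// ler_pXn2r ?nnegrE ?maxpart_ge0//.
  exact: le_maxpart.
have [->|s0] := eqVneq s 0; first by rewrite invr0 mulr0.
by rewrite ler_pdivrMr ?mul1r// lt_def s0 sqrtr_ge0.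
Qed.

(** The one-step inequalities telescope. At time [n] the potential is at least
    [a n / 2 - 12 * sqpart f n x], its other two quotients being nonnegative, and [a n] dominates
    [maxpart f n x]. *)
Lemma davis_pathwise f n x :
  maxpart f n x / 2 <= 12 * sqpart f n x +
    \sum_(0 <= k < n) davis_transform f k x * mdiff k.+1 f x.
Proof.
pose a n := Num.sqrt (sqpart f n x ^+ 2 + maxpart f n x ^+ 2).
have a0 m : 0 <= a m by exact: sqrtr_ge0.
have aE m : a m ^+ 2 = sqpart f m x ^+ 2 + maxpart f m x ^+ 2.
  by rewrite sqr_sqrtr// addr_ge0 ?sqr_ge0.
have pot : davis_potential (f n x) (a n) (sqpart f n x) <=
    \sum_(0 <= k < n) davis_transform f k x * mdiff k.+1 f x.
  elim: n => [|n ih].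
    rewrite big_geq//.
    (* The initial value is treated as a jump from the zero state, where the convention [0^-1 = 0]
       makes the potential and the slope vanish. *)
    have := @davis_step _ 0 (f 0%N x) 0 (sqpart f 0 x) 0 (a 0%N) 0
      (maxpart f 0 x) (lexx _) (sqpart_ge0 _ _ _) (lexx _) (a0 _) _ _ _ _ (aE _).
    rewrite {2}/davis_potential invr0 !mulr0 mul0r !addr0 !mul0r subrr !subr0.
    apply; rewrite ?normr0 ?maxpart0 ?expr0n ?addr0 ?subr0//.
      by rewrite max_r.
    by rewrite sqpart0 real_normK ?num_real ?add0r.
  rewrite big_nat_recr//=; apply: le_trans (lerD ih (lexx _)); rewrite -lerBlDl.
  apply: (davis_step (m := maxpart f n x) (m' := maxpart f n.+1 x)) => //.
  - exact: sqpart_ge0.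
  - exact: sqpart_ge0.
  - exact: le_maxpart.
  - by rewrite sqr_sqpartS.
have Ma : maxpart f n x <= a n.
  by rewrite -(@ler_pXn2r _ 2) ?nnegrE ?maxpart_ge0// aE lerDr sqr_ge0.
have : 0 <= f n x ^+ 2 / a n by rewrite divr_ge0 ?sqr_ge0.
have : 0 <= sqpart f n x ^+ 2 / a n by rewrite divr_ge0 ?sqr_ge0.
move: pot; rewrite /davis_potential; lra.
Qed.

(** For consecutive values p <= r of the square function, D^2 / r = (r - p)(r + p) / r <= 2 (r - p),
    which telescopes. It controls the [f] half of the splitting in Fefferman's inequality. *)
Lemma sum_mdiff_div_sqpart f n x :
  \sum_(0 <= k < n.+1) mdiff k f x ^+ 2 / sqpart f k x <= 2 * sqpart f n x.
Proof.
have step (p r D : R) : 0 <= p -> 0 <= r -> r ^+ 2 = p ^+ 2 + D ^+ 2 ->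
    D ^+ 2 / r <= 2 * (r - p).
  move=> p0 r0 rE; have [r00|rn0] := eqVneq r 0.
    by rewrite r00 invr0 mulr0 in rE *; nra.
  rewrite ler_pdivrMr ?lt_def ?rn0//; nra.
elim: n => [|n ih].
  rewrite big_nat1 -[leRHS]subr0 -[in leRHS](mulr0 2) -mulrBr.
  apply: step => //; first exact: sqpart_ge0.
  by rewrite sqr_sqpart big_nat1 expr0n add0r.
rewrite big_nat_recr//=.
have := step _ _ (mdiff n.+1 f x) (sqpart_ge0 f n x) (sqpart_ge0 f n.+1 x) (sqr_sqpartS _ _ _).
lra.
Qed.

End pathwise.

Section measurable_real.
Context {d : measure_display} {T : measurableType d} {R : realType}.
Implicit Types X : T -> R.

Lemma measurable_fun_sqrtr X : measurable_fun [set: T] X ->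
  (forall x, 0 <= X x) -> measurable_fun [set: T] (fun x => Num.sqrt (X x)).
Proof.
move=> mX X0; under eq_fun => x do rewrite -powR12_sqrt//.
exact: (measurableT_comp (measurable_powR _) mX).
Qed.

Lemma measurable_fun_ge0_inv X : measurable_fun [set: T] X ->
  (forall x, 0 <= X x) -> measurable_fun [set: T] (fun x => (X x)^-1).
Proof.
move=> mX X0; under eq_fun => x do rewrite -powR_inv1//.
exact: (measurableT_comp (measurable_powR _) mX).
Qed.

Lemma measurable_fun_sumr (f : nat -> T -> R) m n :
  (forall i, (i < n)%N -> measurable_fun [set: T] (f i)) ->
  measurable_fun [set: T] (fun x => \sum_(m <= i < n) f i x).
Proof.
elim: n => [|n ih] mf; first by under eq_fun do rewrite big_geq//; exact: measurable_cst.
have [mn|nm] := leqP m n; last first.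
  by under eq_fun do rewrite big_geq//; exact: measurable_cst.
under eq_fun do rewrite big_nat_recr//.
apply: measurable_funD; last exact: mf.
by apply: ih => i ni; apply: mf; exact: leqW.
Qed.

End measurable_real.

(** * Filtrations, martingale differences and Davis' inequality *)

Section filtration.
Context {d : measure_display} {T : measurableType d} {R : realType}.
Variables (P : probability T R) (F : nat -> set (set T)).
Hypothesis hF : filtration F.

Lemma filtration_sigma n : sigma_algebra [set: T] (F n).
Proof. by case: hF. Qed.
Local Hint Resolve filtration_sigma : core.

Lemma filtration_measurable n : F n `<=` d.-measurable.
Proof. by case: hF. Qed.

Lemma filtration_le m n : (m <= n)%N -> F m `<=` F n.
Proof. by case: hF => _ _; exact. Qed.

Lemma measurable_fun_filtration {d'} {S : measurableType d'} n (X : T -> S) :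
  measurable_fun [set: g_sigma_algebraType (F n)] X -> measurable_fun [set: T] X.
Proof.
exact: (measurable_fun_sub (filtration_sigma n) (@filtration_measurable n)).
Qed.

Lemma measurable_fun_filtration_le {d'} {S : measurableType d'} m n (X : T -> S) :
  (m <= n)%N -> measurable_fun [set: g_sigma_algebraType (F m)] X ->
  measurable_fun [set: g_sigma_algebraType (F n)] X.
Proof.
move=> mn mX _ A mA; apply: measurable_sub => //.
by apply: (filtration_le mn); apply: sub_measurable => //; exact: mX.
Qed.

Section adapted.
Variable f : process T R.
Hypothesis af : adapted F f.

Lemma adapted_le m n : (m <= n)%N ->
  measurable_fun [set: g_sigma_algebraType (F n)] (f m).
Proof. by move=> mn; exact: (measurable_fun_filtration_le mn (@af m)). Qed.

Lemma adapted_measurable n : measurable_fun [set: T] (f n).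
Proof. exact: measurable_fun_filtration (@af n). Qed.

Lemma lag_adapted m n : (m <= n.+1)%N ->
  measurable_fun [set: g_sigma_algebraType (F n)] (lag f m).
Proof. by case: m => [|m] mn; [exact: measurable_cst|exact: (@adapted_le m n mn)]. Qed.

Lemma lag_measurable n : measurable_fun [set: T] (lag f n).
Proof. by case: n => [|n]; [exact: measurable_cst|exact: (@adapted_measurable n)]. Qed.

Lemma mdiff_adapted m n : (m <= n)%N ->
  measurable_fun [set: g_sigma_algebraType (F n)] (mdiff m f).
Proof.
move=> mn; apply: measurable_funB; first exact: adapted_le.
by apply: lag_adapted; exact: leqW.
Qed.

Lemma mdiff_measurable n : measurable_fun [set: T] (mdiff n f).
Proof. exact: measurable_fun_filtration (mdiff_adapted (leqnn n)). Qed.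

Lemma sqpart_adapted : adapted F (sqpart f).
Proof.
move=> n; apply: measurable_fun_sqrtr; last first.
  by move=> x; rewrite sumr_ge0// => k _; exact: sqr_ge0.
apply: measurable_fun_sumr => k kn.
by apply: measurable_funX; exact: mdiff_adapted.
Qed.

Lemma maxpart_adapted : adapted F (maxpart f).
Proof.
elim=> [|n ih]; first by apply: measurableT_comp => //; exact: af.
apply: measurable_maxr; first exact: (measurable_fun_filtration_le (leqnSn n) ih).
by apply: measurableT_comp => //; exact: af.
Qed.

Lemma davis_transform_adapted : adapted F (davis_transform f).
Proof.
move=> n; apply: measurable_funM; first exact: af.
apply: measurable_fun_ge0_inv; last by move=> x; exact: sqrtr_ge0.
apply: measurable_fun_sqrtr; last by move=> x; rewrite addr_ge0 ?sqr_ge0.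
apply: measurable_funD; apply: measurable_funX.
  exact: sqpart_adapted.
exact: maxpart_adapted.
Qed.

End adapted.

Local Open Scope ereal_scope.

Section martingale_difference.
Variable f : process T R.
Hypothesis mf : martingale P F f.

Lemma martingale_adapted : adapted F f. Proof. by case: mf. Qed.
Local Hint Resolve martingale_adapted : core.

Lemma integrable_lag n : P.-integrable [set: T] (EFin \o lag f n).
Proof.
case: n => [|n]; first exact: integrable0.
by case: mf => _ + _; apply.
Qed.

Lemma integrable_mdiff n : P.-integrable [set: T] (EFin \o mdiff n f).
Proof.
rewrite (_ : EFin \o _ = ((EFin \o f n) \- (EFin \o lag f n)))//.
apply: integrableB => //; last exact: integrable_lag.
by case: mf => _ + _; apply.
Qed.

Lemma integral_mdiff0 n A : F n A -> \int[P]_(x in A) (mdiff n.+1 f x)%:E = 0.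
Proof.
move=> FA; have mA := filtration_measurable FA.
have iA m : P.-integrable A (EFin \o f m).
  by case: mf => _ + _ => /(_ m) i; exact: integrableS i.
under eq_integral do rewrite EFinB.
rewrite integralB//=; [|exact: iA..].
case: mf => _ _ /(_ n)[_ _ /(_ _ FA) ->].
by rewrite subee// integrable_fin_num//; exact: iA.
Qed.

(** This is how the martingale property enters Davis' inequality, the orthogonality of increments
    and the proof that the paraproduct part is a martingale. *)
Lemma integral_mdiff_weight0 n (X : T -> R) :
  measurable_fun [set: g_sigma_algebraType (F n)] X ->
  P.-integrable [set: T] (fun x => (X x * mdiff n.+1 f x)%:E) ->
  \int[P]_x (X x * mdiff n.+1 f x)%:E = 0.
Proof.
apply: (integral_weight0 (filtration_sigma n) (@filtration_measurable n)).
  exact: integrable_mdiff.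
exact: integral_mdiff0.
Qed.

(** Integrating [davis_pathwise] kills the transform: its integrand is bounded by 1, so each term is
    integrable with no more than [f n] in L^1. The constant is twice the 12 of the potential. *)
Lemma davis_inequality n :
  \int[P]_x (maxpart f n x)%:E <= 24%:E * \int[P]_x (sqpart f n x)%:E.
Proof.
have mS := measurable_fun_filtration (@sqpart_adapted _ martingale_adapted n).
have mM := measurable_fun_filtration (@maxpart_adapted _ martingale_adapted n).
have S0 : 0 <= \int[P]_x (sqpart f n x)%:E.
  by apply: integral_ge0 => x _; rewrite lee_fin sqpart_ge0.
have [->|Sy] := eqVneq (\int[P]_x (sqpart f n x)%:E) +oo.
  by rewrite mulry gtr0_sg ?mul1e ?leey.
have iS : P.-integrable [set: T] (EFin \o sqpart f n).
  apply/integrableP; split; first exact/measurable_EFinP.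
  under eq_integral do rewrite /= ger0_norm ?sqpart_ge0//.
  by rewrite ltey.
have ih k : P.-integrable [set: T]
    (fun x => (davis_transform f k x * mdiff k.+1 f x)%:E).
  apply: le_integrable (integrable_mdiff k.+1) => //.
    apply/measurable_EFinP/measurable_funM.
      exact: measurable_fun_filtration (@davis_transform_adapted _ martingale_adapted k).
    exact: mdiff_measurable.
  move=> x _; rewrite /= lee_fin normrM ler_piMl//.
  exact: davis_transform_le1.
have h0 : \int[P]_x (\sum_(0 <= k < n) davis_transform f k x * mdiff k.+1 f x)%:E = 0.
  under eq_integral do rewrite -sumEFin.
  rewrite integral_sum// big1// => k _; apply: integral_mdiff_weight0 => //.
  exact: davis_transform_adapted.
have isum : P.-integrable [set: T]
  (fun x => (\sum_(0 <= k < n) davis_transform f k x * mdiff k.+1 f x)%:E).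
  under eq_fun do rewrite -sumEFin.
  exact: integrable_sum.
pose H x := (\sum_(0 <= k < n) davis_transform f k x * mdiff k.+1 f x)%R.
have {}h0 : \int[P]_x (H x)%:E = 0 by [].
have {}isum : P.-integrable [set: T] (EFin \o H) by [].
have i24 : P.-integrable [set: T] (fun x => (24 * sqpart f n x)%:E).
  by under eq_fun do rewrite EFinM; exact: integrableZl.
have i2 : P.-integrable [set: T] (fun x => (2 * H x)%:E).
  by under eq_fun do rewrite EFinM; exact: integrableZl.
apply: (@le_trans _ _ (\int[P]_x (24 * sqpart f n x + 2 * H x)%:E)).
  apply: ge0_le_integral => //=.
  - by move=> x _; rewrite lee_fin maxpart_ge0.
  - exact/measurable_EFinP.
  - by under eq_fun do rewrite EFinD; exact: measurable_int (integrableD measurableT i24 i2).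
  - by move=> x _; rewrite lee_fin; have := davis_pathwise f n x; rewrite -/(H x); lra.
under eq_integral do rewrite EFinD.
rewrite integralD//=.
under eq_integral do rewrite EFinM.
rewrite integralZl//; under [X in _ + X]eq_integral do rewrite EFinM.
by rewrite integralZl// h0 mule0 adde0.
Qed.

End martingale_difference.
End filtration.

(** * Conditional Jensen inequality and essential bounds, tested on sets *)

Section conditional_bounds.
Context {d : measure_display} {T : measurableType d} {R : realType}.
Variables (P : probability T R) (G : set (set T)).
Hypotheses (sG : sigma_algebra [set: T] G) (GT : G `<=` d.-measurable).
Local Open Scope ereal_scope.

(** The set where [Y >= 0] and its complement belong to [G]; on each of them [|Y|] is [Y] or [- Y],
    which may be exchanged for [X] or [- X] under the integral. *)
Lemma integral_norm_cexp_le (X Y : T -> R) : is_cexp P G X Y ->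
  P.-integrable [set: T] (EFin \o X) ->
  forall A, G A -> \int[P]_(x in A) `|Y x|%:E <= \int[P]_(x in A) `|X x|%:E.
Proof.
move=> [mY iY YX] iX A GA; have mA := GT GA.
have mX1 : measurable_fun [set: T] X.
  by apply/measurable_EFinP; exact: measurable_int iX.
have mY1 : measurable_fun [set: T] Y by exact: measurable_fun_sub mY.
pose B := [set x | (0 <= Y x)%R].
have GB : G B.
  apply: sub_measurable => //; rewrite (_ : B = Y @^-1` `[0%R, +oo[).
    by rewrite -[_ @^-1` _]setTI; exact: mY.
  by apply/seteqP; split => x /=; rewrite in_itv/= andbT.
have mB := GT GB.
have GAB : G (A `&` B).
  apply: sub_measurable => //; apply: measurableI; exact: measurable_sub.
have GADB : G (A `\` B).
  apply: sub_measurable => //; apply: measurableD; exact: measurable_sub.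
have AE : A = (A `&` B) `|` (A `\` B) by rewrite setUIDK.
have split_int (Z : T -> R) : measurable_fun [set: T] Z ->
    \int[P]_(x in A) `|Z x|%:E =
    \int[P]_(x in A `&` B) `|Z x|%:E + \int[P]_(x in A `\` B) `|Z x|%:E.
  move=> mZ; rewrite {1}AE ge0_integral_setU//.
  - exact: GT.
  - exact: GT.
  - by apply: measurable_funTS; apply/measurable_EFinP; exact: measurableT_comp.
  - by apply/disj_set2P; rewrite setDE setIACA setICr setI0.
have sub_int (C : set T) : d.-measurable C ->
    P.-integrable C (EFin \o X) /\ P.-integrable C (EFin \o Y).
  by move=> mC; split; apply: integrableS (measurableT) mC (@subsetT _ C) _.
rewrite !split_int//; apply: leeD.
  rewrite (eq_integral (fun x => (Y x)%:E)); last first.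
    by move=> x /set_mem[_ Bx]; rewrite ger0_norm.
  rewrite YX//; have [iXC _] := sub_int _ (GT GAB).
  apply: le_integral => //; [exact: GT|exact: (integrable_abse iXC)|].
  by move=> x _; rewrite lee_fin ler_norm.
rewrite (eq_integral (fun x => (- (Y x))%:E)); last first.
  by move=> x /set_mem[_ /negP]; rewrite -ltNge => Y0; rewrite ltr0_norm.
have [iXC iYC] := sub_int _ (GT GADB).
under eq_integral do rewrite EFinN.
rewrite integralN ?YX//; last first.
  by apply: integrable_add_def; [exact: GT|exact: iYC].
rewrite -integralN; last first.
  by apply: integrable_add_def; [exact: GT|exact: iXC].
apply: le_integral => //.
- exact: GT.
- exact: (integrableN iXC).
- exact: (integrable_abse iXC).
- by move=> x _; rewrite lee_fin -normrN ler_norm.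
Qed.

(** Tested on the set where [|Y| > K], the hypothesis forces the integral of the positive function
    [|Y| - K] over it to vanish, so this set is null. *)
Lemma ae_le_of_integral_le (Y : T -> R) (K : R) :
  measurable_fun [set: g_sigma_algebraType G] Y -> (0 <= K)%R ->
  (forall A, G A -> \int[P]_(x in A) `|Y x|%:E <= K%:E * P A) ->
  {ae P, forall x, (`|Y x| <= K)%R}.
Proof.
move=> mY K0 YK.
pose B := [set x | (K < `|Y x|)%R].
have GB : G B.
  apply: sub_measurable => //; rewrite (_ : B = (Num.norm \o Y) @^-1` `]K, +oo[).
    by rewrite -[_ @^-1` _]setTI; apply: (measurableT_comp _ mY).
  by apply/seteqP; split => x /=; rewrite in_itv/= andbT.
exists B; split; [exact: GT| |by move=> x /= /negP; rewrite -ltNge].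
have mB := GT GB; have mY1 := measurable_fun_sub sG GT mY.
have mh : measurable_fun B (fun x => (`|Y x| - K)%:E).
  apply: measurable_funTS; apply/measurable_EFinP; apply: measurable_funB => //.
  exact: measurableT_comp.
have : \int[P]_(x in B) `|(`|Y x| - K)%:E| = 0.
  have h0 : 0 <= \int[P]_(x in B) `|(`|Y x| - K)%:E| by exact: integral_ge0.
  apply/eqP; rewrite eq_le h0 andbT.
  have := YK _ GB.
  rewrite (eq_integral (fun x => `|(`|Y x| - K)%:E| + K%:E)); last first.
    move=> x /set_mem /= Kx; rewrite [X in _ = X%:E + _]ger0_norm ?subr_ge0 ?ltW//.
    by rewrite -EFinD subrK.
  rewrite ge0_integralD//; last exact: measurableT_comp.
  by rewrite integral_cst// -[leRHS]add0e leeD2rE// fin_numM// fin_num_measure.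
move/ae_eq_integral_abs => /(_ mB mh) ae0.
apply: measure_negligible => //.
apply: negligibleS ae0 => x Bx /= /(_ Bx) [].
by apply/eqP; rewrite subr_eq0 gt_eqF.
Qed.

End conditional_bounds.

(** * Consequences of a finite BMO norm *)

Section bmo_bounds.
Context {d : measure_display} {T : measurableType d} {R : realType}.
Variables (P : probability T R) (F : nat -> set (set T)).
Hypothesis hF : filtration F.
Local Open Scope ereal_scope.

Lemma is_cexpB n (X Y Z : T -> R) : is_cexp P (F n) X Y ->
  P.-integrable [set: T] (EFin \o X) ->
  measurable_fun [set: g_sigma_algebraType (F n)] Z ->
  P.-integrable [set: T] (EFin \o Z) ->
  is_cexp P (F n) (fun x => X x - Z x)%R (fun x => Y x - Z x)%R.
Proof.
move=> [mY iY YX] iX mZ iZ; split.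
- exact: measurable_funB.
- rewrite (_ : EFin \o _ = ((EFin \o Y) \- (EFin \o Z)))//.
  exact: integrableB.
move=> A FA; have mA := filtration_measurable hF FA.
have iA (U : T -> R) : P.-integrable [set: T] (EFin \o U) ->
    P.-integrable A (EFin \o U).
  by move=> iU; exact: integrableS iU.
under eq_integral do rewrite EFinB; rewrite integralB//; [|exact: iA..].
under [RHS]eq_integral do rewrite EFinB; rewrite integralB//; [|exact: iA..].
by rewrite /= YX.
Qed.

Lemma ae_bounded_Lfun (X : T -> R) (c p : R) : (1 <= p)%R ->
  measurable_fun [set: T] X -> {ae P, forall x, (`|X x| <= c)%R} ->
  X \in Lfun P p%:E.
Proof.
move=> p1 mX Xc.
have p1e : 1 <= p%:E by rewrite lee_fin.
apply: (Lfun_subset p1e (leey 1) _ (leey _)); first exact: fin_num_measure.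
rewrite inE; apply/andP; split; rewrite inE//=.
rewrite /finite_norm unlock; case: ifPn => [_|_]; last exact: ltry.
apply: (@le_lt_trans _ _ c%:E); last exact: ltry.
by apply/ess_supP; apply: filterS Xc => x /=; rewrite lee_fin.
Qed.

Section fixed_martingale.
Variables (p b : R) (g : process T R).
Hypotheses (p1 : (1 <= p)%R) (gBMO : BMO P F p g) (gb : BMO_norm P F p g < b%:E).

Lemma bmo_bound_gt0 : (0 < b)%R.
Proof.
rewrite -lte_fin; apply: le_lt_trans gb.
apply: ereal_sup_ge; eexists; first by exists 0%N.
exact: poweR_ge0.
Qed.

Let p0 : (0 < p)%R := lt_le_trans ltr01 p1.
Let b0 := bmo_bound_gt0.

Lemma bmo_martingale : martingale P F g.
Proof. by case: gBMO => -[]. Qed.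

Lemma bmo_is_cexp n : is_cexp P (F n) (flim g) (g n).
Proof. by case: gBMO => -[]. Qed.

Lemma integrable_flim : P.-integrable [set: T] (EFin \o flim g).
Proof.
apply/Lfun1_integrable; case: gBMO => -[_ _ + _] _.
have p1e : 1 <= p%:E by rewrite lee_fin.
by apply: (Lfun_subset (lexx 1) p1e) => //; exact: fin_num_measure.
Qed.

(** Having [lag g n] in L^p makes the argument of [cexp] integrable, so that the chosen version is a
    genuine conditional expectation and its essential bound can be integrated over [A]. *)
Lemma bmo_integral_pow n A : lag g n \in Lfun P p%:E -> F n A ->
  \int[P]_(x in A) (`|flim g x - lag g n x| `^ p)%:E <= (b `^ p)%:E * P A.
Proof.
move=> glag FA; set X := (fun x => `|flim g x - lag g n x| `^ p)%R.
have iX : P.-integrable [set: T] (EFin \o X).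
  apply: (@Lfun_integrable _ _ _ P (flim g - lag g n)%R) => //.
  by rewrite rpredB//; case: gBMO => -[].
have [mY iY YX] :=
  cexpP (filtration_sigma hF n) (@filtration_measurable _ _ _ hF n) iX.
set Y := cexp P (F n) X in mY iY YX.
rewrite -YX//.
have Yb : {ae P, forall x, (`|Y x| <= b `^ p)%R}.
  have : 'N[P]_+oo[EFin \o Y] `^ p^-1 <= b%:E.
    apply: le_trans (ltW gb); apply: ereal_sup_ge; eexists; first by exists n.
    exact: lexx.
  set N := 'N[P]_+oo[_] => Nb.
  have {}Nb : N <= (b `^ p)%:E.
    have N0 : 0 <= N by exact: Lnorm_ge0.
    rewrite -(poweRe1 N0) -(mulVf (lt0r_neq0 p0)) poweRrM -poweR_EFin.
    by apply: gt0_ler_poweR Nb; rewrite ?ltW// in_itv/= leey ?poweR_ge0 ?lee_fin ?ltW.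
  have /ess_supP : ess_sup P (abse \o (EFin \o Y)) <= (b `^ p)%:E.
    move: Nb; rewrite /N unlock; case: ifPn => [//|/negP[]].
    by have : 0 < P [set: T] by rewrite probability_setT.
  by apply: filterS => x; rewrite /= lee_fin.
have mA := filtration_measurable hF FA.
have mY1 := measurable_fun_filtration hF mY.
apply: (@le_trans _ _ (\int[P]_(x in A) (`|Y x|)%:E)).
  have iYA := integrableS measurableT mA (@subsetT _ A) iY.
  apply: le_integral => //; first exact: (integrable_abse iYA).
  by move=> x _; rewrite lee_fin ler_norm.
rewrite -integral_cst//; apply: ae_ge0_le_integral => //.
- by apply: measurable_funTS; apply/measurable_EFinP; exact: measurableT_comp.
- by move=> x _; rewrite lee_fin powR_ge0.
- by apply: filterS Yb => x + _; rewrite lee_fin.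
Qed.

(** In place of Holder's inequality: [|z| <= b + b^(1-p) |z|^p] holds pointwise, the first term
    serving for [|z| <= b] and the second beyond, and each term integrates to at most [b * P A]. *)
Lemma bmo_integral_of_lag n A : lag g n \in Lfun P p%:E -> F n A ->
  \int[P]_(x in A) `|flim g x - lag g n x|%:E <= (2 * b)%:E * P A.
Proof.
move=> glag FA.
have mA := filtration_measurable hF FA.
have le_pow (z : R) : (`|z| <= b + b / b `^ p * `|z| `^ p)%R.
  have bp0 : (0 < b `^ p)%R by exact: powR_gt0.
  have [zb|bz] := leP `|z|%R b.
    by rewrite ler_wpDr// mulr_ge0 ?powR_ge0// divr_ge0 ?ltW.
  have zb1 : (1 <= `|z| / b)%R by rewrite ler_pdivlMr// mul1r ltW.
  have zE : (b * (`|z| / b) = `|z|)%R by rewrite mulrC divfK ?gt_eqF.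
  apply: ler_wpDl; first exact: ltW.
  have -> : (b / b `^ p * `|z| `^ p = b * (`|z| / b) `^ p)%R.
    rewrite -{1}zE powRM ?ltW// ?(lt_le_trans ltr01)//.
    by rewrite mulrA divfK ?gt_eqF.
  rewrite -{1}zE ler_pM2l//.
  exact: le1r_powR.
have mX : measurable_fun [set: T] (fun x => `|flim g x - lag g n x|)%R.
  apply: measurableT_comp => //; apply: measurable_funB.
    by apply/measurable_EFinP; exact: measurable_int integrable_flim.
  exact: (@lag_measurable _ _ _ F hF g (martingale_adapted bmo_martingale) n).
have mXp : measurable_fun [set: T] (fun x => `|flim g x - lag g n x| `^ p)%R.
  exact: (measurableT_comp (measurable_powR p) mX).
have mXA : measurable_fun A (fun x => `|flim g x - lag g n x|%:E).
  by apply: measurable_funTS; exact/measurable_EFinP.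
have mXpA : measurable_fun A (fun x => (`|flim g x - lag g n x| `^ p)%:E).
  by apply: measurable_funTS; exact/measurable_EFinP.
have X0 x : A x -> 0 <= (`|flim g x - lag g n x| `^ p)%:E.
  by rewrite lee_fin powR_ge0.
have be0 : 0 <= b%:E by rewrite lee_fin ltW.
have c0 : 0 <= (b / b `^ p)%:E by rewrite lee_fin divr_ge0 ?powR_ge0 ?ltW.
have mc : measurable_fun A (fun x => (b / b `^ p)%:E * (`|flim g x - lag g n x| `^ p)%:E).
  exact: measurable_funeM.
apply: (@le_trans _ _ (\int[P]_(x in A)
   (b%:E + (b / b `^ p)%:E * (`|flim g x - lag g n x| `^ p)%:E))).
  apply: ge0_le_integral => //.
    exact: emeasurable_funD.
  by move=> x _; rewrite lee_fin le_pow.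
rewrite ge0_integralD//; last by move=> x Ax; rewrite mule_ge0// X0.
rewrite integral_cst// ge0_integralZl//.
rewrite mulr_natl mulr2n EFinD ge0_muleDl// leeD2l//.
apply: le_trans (lee_wpmul2l c0 (bmo_integral_pow glag FA)) _.
by rewrite muleA -EFinM divfK// gt_eqF// powR_gt0.
Qed.

(* [cexp] has its intended meaning only on integrable arguments, so that the BMO norm says
   nothing at time [n] before [lag g n] is known to be in L^p. Hence the induction: the BMO
   bound at time [n] makes [g n - lag g n] bounded. *)
Lemma bmo_lag_mdiff n :
  {ae P, forall x, (`|lag g n x| <= n%:R * (2 * b))%R} /\
  {ae P, forall x, (`|mdiff n g x| <= 2 * b)%R}.
Proof.
have step m : {ae P, forall x, (`|lag g m x| <= m%:R * (2 * b))%R} ->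
    {ae P, forall x, (`|mdiff m g x| <= 2 * b)%R}.
  move=> lagm.
  have lagL : lag g m \in Lfun P p%:E.
    apply: ae_bounded_Lfun lagm => //.
    exact: (@lag_measurable _ _ _ F hF g (martingale_adapted bmo_martingale) m).
  apply: (ae_le_of_integral_le (filtration_sigma hF m) (@filtration_measurable _ _ _ hF m)).
  - exact: (@mdiff_adapted _ _ _ F hF g (martingale_adapted bmo_martingale) m m).
  - by rewrite mulr_ge0// ltW.
  move=> A FA; apply: le_trans (bmo_integral_of_lag lagL FA).
  have := integral_norm_cexp_le (filtration_sigma hF m) (@filtration_measurable _ _ _ hF m).
  apply => //.
    apply: is_cexpB; first exact: bmo_is_cexp.
    - exact: integrable_flim.
    - exact: (@lag_adapted _ _ _ F hF g (martingale_adapted bmo_martingale) m m).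
    - exact: (integrable_lag bmo_martingale).
  rewrite (_ : EFin \o _ = ((EFin \o flim g) \- (EFin \o lag g m)))//.
  apply: integrableB => //; first exact: integrable_flim.
  exact: (integrable_lag bmo_martingale).
elim: n => [|n [ihl ihm]].
  have h : {ae P, forall x, (`|lag g 0 x| <= 0%:R * (2 * b))%R}.
    by apply: nearW => x; rewrite /= normr0 mul0r.
  by split => //; exact: step.
have h : {ae P, forall x, (`|lag g n.+1 x| <= n.+1%:R * (2 * b))%R}.
  apply: filterS2 ihl ihm => x hl hm.
  rewrite -[lag g n.+1 x](subrKC (lag g n x)) (le_trans (ler_normD _ _))//.
  by rewrite -natr1 mulrDl mul1r lerD.
by split => //; exact: step.
Qed.

Lemma bmo_integral n A : F n A ->
  \int[P]_(x in A) `|flim g x - lag g n x|%:E <= (2 * b)%:E * P A.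
Proof.
apply: bmo_integral_of_lag; apply: ae_bounded_Lfun (bmo_lag_mdiff n).1 => //.
exact: (@lag_measurable _ _ _ F hF g (martingale_adapted bmo_martingale) n).
Qed.

End fixed_martingale.
End bmo_bounds.

(** * The John-Nirenberg inequality *)

Section john_nirenberg.
Context {d : measure_display} {T : measurableType d} {R : realType}.
Variables (P : probability T R) (F : nat -> set (set T)).
Hypothesis hF : filtration F.
Local Open Scope ereal_scope.

Variables (g : process T R) (ginf : T -> R) (K : R).
Hypotheses (mg : martingale P F g) (iginf : P.-integrable [set: T] (EFin \o ginf)).
Hypotheses (gc : forall n, is_cexp P (F n) ginf (g n)) (K0 : (0 < K)%R).
Hypothesis gK : forall n A, F n A ->
  \int[P]_(x in A) `|ginf x - lag g n x|%:E <= K%:E * P A.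

Let ag : adapted F g := martingale_adapted mg.

Definition exceed (r : R) n m : set T := [set x | (r < `|g m x - lag g n x|)%R].

Lemma exceed_filtration r n m : (n <= m)%N -> F m (exceed r n m).
Proof.
move=> nm; apply: (sub_measurable (filtration_sigma hF m)).
rewrite (_ : exceed r n m = (fun x => `|g m x - lag g n x|%R) @^-1` `]r, +oo[).
  rewrite -[_ @^-1` _]setTI.
  have : measurable_fun [set: g_sigma_algebraType (F m)] (fun x => `|g m x - lag g n x|%R).
    apply: measurableT_comp => //; apply: measurable_funB; first exact: (@ag m).
    by apply: (lag_adapted hF ag); exact: leqW.
  exact.
by apply/seteqP; split => x; rewrite /exceed /= in_itv/= andbT.
Qed.

(* On [B], the first time at or after [n] at which [g - lag g n] leaves [-2K, 2K] is [n + j]. *)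
Definition first_exit (B : set T) n := seqDU (fun j => B `&` exceed (2 * K) n (n + j)).

Lemma first_exit_filtration B n j : F n B -> F (n + j)%N (first_exit B n j).
Proof.
move=> FB.
have mE i : (i <= j)%N ->
    (F (n + j)%N).-sigma.-measurable (B `&` exceed (2 * K) n (n + i)).
  move=> ij; apply: measurableI; apply: (measurable_sub (filtration_sigma hF _)).
    exact: (filtration_le hF (leq_addr _ _) FB).
  apply: (filtration_le hF (_ : n + i <= n + j)%N); first by rewrite leq_add2l.
  by apply: exceed_filtration; rewrite leq_addr.
apply: (sub_measurable (filtration_sigma hF _)); apply: measurableD; first exact: mE.
by apply: bigsetU_measurable => i _; apply: mE; exact: ltnW.
Qed.

Lemma first_exit_measurable B n j : F n B -> d.-measurable (first_exit B n j).
Proof.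
by move=> FB; exact: (filtration_measurable hF (first_exit_filtration j FB)).
Qed.

(** On the piece exiting at time n + j the deviation exceeds 2K, and by conditional Jensen its
    integral there is at most that of |ginf - g_{n-1}|. The pieces are disjoint subsets of [B], so
    these integrals add up to at most K P(B), half of what 2K would give on all of [B]. *)
Lemma first_exit_prob B n : F n B ->
  \sum_(j <oo) P (first_exit B n j) <= (2^-1)%:E * P B.
Proof.
move=> FB; have mB := filtration_measurable hF FB.
pose X x : \bar R := `|ginf x - lag g n x|%:E.
have mX : measurable_fun [set: T] X.
  apply/measurable_EFinP; apply: measurableT_comp => //; apply: measurable_funB.
    by apply/measurable_EFinP; exact: measurable_int iginf.
  exact: (lag_measurable hF ag).
have mD j := first_exit_measurable j FB.
have DX j : (2 * K)%:E * P (first_exit B n j) <= \int[P]_(x in first_exit B n j) X x.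
  apply: (@le_trans _ _ (\int[P]_(x in first_exit B n j) `|g (n + j)%N x - lag g n x|%:E)).
    rewrite -integral_cst//; apply: ge0_le_integral => //.
    - by move=> x _; rewrite lee_fin mulr_ge0// ltW.
    - apply: measurable_funTS; apply/measurable_EFinP; apply: measurableT_comp => //.
      apply: measurable_funB; first exact: (adapted_measurable hF ag).
      exact: (lag_measurable hF ag).
    - by move=> x [[_ xE] _]; rewrite lee_fin ltW.
  apply: (integral_norm_cexp_le (filtration_sigma hF _)
    (@filtration_measurable _ _ _ hF _)); last exact: first_exit_filtration.
    apply: (is_cexpB hF) => //.
      by apply: (lag_adapted hF ag); rewrite leqW// leq_addr.
    exact: (integrable_lag mg).
  rewrite (_ : EFin \o _ = ((EFin \o ginf) \- (EFin \o lag g n)))//.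
  by apply: integrableB => //; exact: (integrable_lag mg).
have sumX : \sum_(j <oo) (2 * K)%:E * P (first_exit B n j) <= K%:E * P B.
  apply: le_trans (gK FB).
  apply: (@le_trans _ _ (\int[P]_(x in \bigcup_j first_exit B n j) X x)).
    rewrite ge0_integral_bigcup//.
    - by apply: lee_nneseries => // j _ _; rewrite mule_ge0// lee_fin mulr_ge0// ltW.
    - exact: measurable_funTS.
    - by move=> x _; rewrite lee_fin.
    - exact: trivIset_seqDU.
  apply: ge0_subset_integral => //.
  - exact: bigcup_measurable.
  - exact: measurable_funTS.
  - by move=> x _; rewrite lee_fin.
  - by move=> x [j _ xj]; case: (subset_seqDU xj).
rewrite nneseriesZl// in sumX.
rewrite -(@lee_pmul2l _ (2 * K)%:E) ?lte_fin ?mulr_gt0//.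
by rewrite muleA -EFinM mulrAC mulfV ?mul1r.
Qed.

Definition far k n : set T := \bigcup_j exceed (3 * k%:R * K) n (n + j).

Lemma far_measurable k n : d.-measurable (far k n).
Proof.
apply: bigcup_measurable => j _.
by apply: (filtration_measurable hF (@exceed_filtration _ n (n + j)%N _)); rewrite leq_addr.
Qed.

(** Just before the exit time n + j the process is within 2K of g_{n-1}, so a deviation above
    3(k+1)K from g_{n-1} is one above 3kK from g_{n+j-1}. Since distances are taken to the lag, the
    jump at the exit is charged to the restarted process and needs no separate bound. *)
Lemma far_succ_subset B n k :
  B `&` far k.+1 n `<=` \bigcup_j (first_exit B n j `&` far k (n + j)).
Proof.
move=> x [Bx [i _ xi]].
have : (\bigcup_j (B `&` exceed (2 * K) n (n + j))) x.
  exists i => //; split => //; move: xi; rewrite /exceed /=; apply: le_lt_trans.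
  by rewrite ler_wpM2r ?ltW// -natr1; have : (0 <= k%:R :> R)%R by []; lra.
rewrite seqDU_bigcup_eq => -[j _ xj]; exists j => //; split => //.
have notE l : (l < j)%N -> (`|g (n + l)%N x - lag g n x| <= 2 * K)%R.
  move=> lj; rewrite leNgt; apply/negP => xl; case: xj => _; apply.
  rewrite -(bigcup_mkord j (fun l => B `&` exceed (2 * K) n (n + l))); exists l => //.
have ji : (j <= i)%N.
  rewrite leqNgt; apply/negP => /notE; apply/negP; rewrite -ltNge.
  move: xi; rewrite /exceed /=; apply: le_lt_trans.
  by rewrite ler_wpM2r ?ltW// -natr1; have : (0 <= k%:R :> R)%R by []; lra.
exists (i - j)%N => //; rewrite /exceed /= -addnA subnKC//.
(* For [j = 0] there is no earlier time to appeal to, but the two lags coincide. *)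
have lagj : (`|lag g (n + j) x - lag g n x| <= 2 * K)%R.
  case: j xj notE ji => [|j] _ notE _.
    by rewrite addn0 subrr normr0 mulr_ge0// ltW.
  by rewrite addnS; exact: notE.
move: xi; rewrite /exceed /= => xi.
have := ler_distD (lag g (n + j) x) (g (n + i)%N x) (lag g n x).
move: xi lagj; rewrite -natr1; set a := `|_|%R; set b := `|_|%R; set c := `|_|%R.
have := K0; nra.
Qed.

(** Each restart at a first exit halves the probability. The induction runs over all [n] and [B],
    because the restart takes place at time [n + j] on the piece of [F (n + j)] that exits there. *)
Lemma john_nirenberg k n B : F n B -> P (B `&` far k n) <= (2^-1 ^+ k)%:E * P B.
Proof.
elim: k n B => [|k ih] n B FB; have mB := filtration_measurable hF FB.
  rewrite expr0 mul1e; apply: le_measure; rewrite ?inE//.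
  by apply: measurableI => //; exact: far_measurable.
have mfe j := first_exit_measurable j FB.
apply: (@le_trans _ _ (\sum_(j <oo) P (first_exit B n j `&` far k (n + j)))).
  apply: measure_sigma_subadditive => //; last exact: far_succ_subset.
    by move=> j; apply: measurableI => //; exact: far_measurable.
  by apply: measurableI => //; exact: far_measurable.
apply: (@le_trans _ _ (\sum_(j <oo) (2^-1 ^+ k)%:E * P (first_exit B n j))).
  apply: lee_nneseries => // j _; apply: ih; exact: first_exit_filtration.
rewrite nneseriesZl// exprSr EFinM -muleA lee_wpmul2l//.
exact: first_exit_prob.
Qed.

(* The factor [3 / 2] is less than the decay rate [2] of the tails and at least [expR 3^-1]. *)
Definition jn_weight n x : \bar R :=
  1 + \sum_(k <oo) ((3 / 2) ^+ k)%:E * (\1_(far k n) x)%:E.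

Let term_ge0 k n x : 0 <= ((3 / 2) ^+ k)%:E * (\1_(far k n) x)%:E :> \bar R.
Proof. by rewrite mule_ge0 ?lee_fin// exprn_ge0// divr_ge0. Qed.

Lemma jn_weight_ge0 n x : 0 <= jn_weight n x.
Proof. by rewrite adde_ge0// nneseries_ge0. Qed.

Lemma measurable_jn_weight n : measurable_fun [set: T] (jn_weight n).
Proof.
apply: emeasurable_funD => //; apply: ge0_emeasurable_sum => //.
move=> k _; apply: measurable_funeM; apply/measurable_EFinP.
by apply: measurable_indic; exact: far_measurable.
Qed.

(** The tail bound makes the series geometric with ratio 3/2 * 1/2 = 3/4, hence sum 4, and the
    leading 1 gives 5. *)
Lemma integral_jn_weight n B : F n B -> \int[P]_(x in B) jn_weight n x <= 5%:E * P B.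
Proof.
move=> FB; have mB := filtration_measurable hF FB.
have mt k : measurable_fun B (fun x => ((3 / 2) ^+ k)%:E * (\1_(far k n) x)%:E : \bar R).
  apply: measurable_funTS; apply: measurable_funeM; apply/measurable_EFinP.
  by apply: measurable_indic; exact: far_measurable.
rewrite ge0_integralD//; last 2 first.
  by move=> x _; exact: nneseries_ge0.
  exact: ge0_emeasurable_sum.
rewrite integral_cst// integral_nneseries//.
have -> : 5%:E = 1 + 4%:E :> \bar R by rewrite -EFinD; congr EFin; lra.
rewrite ge0_muleDl ?lee_fin// leeD2l//.
apply: (@le_trans _ _ (\sum_(k <oo) P B * ((3 / 4) ^+ k)%:E)).
  apply: lee_nneseries => [k _ _|k _].
    by apply: integral_ge0.
  rewrite ge0_integralZl//; last first.
    apply: measurable_funTS; apply/measurable_EFinP.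
    by apply: measurable_indic; exact: far_measurable.
  rewrite integral_indic//; last exact: far_measurable.
  rewrite setIC muleC -(_ : (2^-1 ^+ k)%:E * ((3 / 2) ^+ k)%:E = ((3 / 4) ^+ k)%:E); last first.
    by rewrite -EFinM -exprMn; congr ((_ ^+ _)%:E); lra.
  rewrite muleA lee_wpmul2r//.
  by rewrite muleC; exact: john_nirenberg.
rewrite -(@fineK _ (P B)) ?fin_num_measure//.
rewrite nneseriesZl; last by move=> k _; rewrite lee_fin exprn_ge0// divr_ge0.
rewrite muleC lee_wpmul2r//; first by rewrite lee_fin fine_ge0.
apply: lime_le; first by apply: is_cvg_nneseries => k _ _; rewrite lee_fin exprn_ge0// divr_ge0.
apply: nearW => n0; rewrite sumEFin lee_fin.
suff -> : (\sum_(0 <= k < n0) (3 / 4) ^+ k = 4 - 4 * (3 / 4) ^+ n0 :> R)%R.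
  by rewrite gerBl mulr_ge0// exprn_ge0// divr_ge0.
elim: n0 => [|m ih]; first by rewrite big_geq// expr0; lra.
by rewrite big_nat_recr//= ih exprS; lra.
Qed.

(** The same weight serves for every [m >= n], so it stands for the exponential of a maximal
    function. The rate is chosen so that each further distance 3K costs a factor exp(1/3) <= 3/2. *)
Lemma expR_jn_weight n m x : (n <= m)%N ->
  (expR (`|g m x - lag g n x| / (9 * K)))%:E <= 2%:E * jn_weight n x.
Proof.
move=> nm; set a := `|_|%R; pose t := (a / K)%R.
have t0 : (0 <= t)%R by rewrite divr_ge0 ?normr_ge0// ltW.
have aE : (a = t * K)%R by rewrite /t divfK// gt_eqF.
have e32 : (expR (3^-1) <= 3 / 2 :> R)%R.
  have := expR_ge1Dx (- (3^-1) : R); rewrite expRN.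
  have e0 := expR_gt0 (3^-1 : R).
  by rewrite -(@ler_pM2r _ (expR 3^-1))// mulVf ?gt_eqF//; lra.
have term_le k : ((3 / 2) ^+ k)%:E * (\1_(far k n) x)%:E <= jn_weight n x.
  rewrite /jn_weight -[leLHS]add0e leeD//.
  apply: le_trans (nneseries_lim_ge k.+1 _); last by move=> i _ _; exact: term_ge0.
  by rewrite big_nat_recr//= leeDr// sume_ge0.
have W1 : 1 <= jn_weight n x.
  by rewrite /jn_weight leeDl// nneseries_ge0.
have ex_k : exists k, (t <= 3 * k.+1%:R)%R.
  exists (Num.trunc t); rewrite (le_trans (ltW (truncnS_gt t)))//.
  by rewrite ler_peMl// ler1n.
(* By minimality [x] lies in [far k n] as soon as [k > 0]; for [k = 0] the leading 1 of the weight
   serves. Going from exponent [k.+1] down to [k] costs 3/2 <= 2. *)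
have [k tk kmin] := ex_minnP ex_k.
have le_e : (expR (a / (9 * K)) <= (3 / 2) ^+ k.+1)%R.
  apply: (@le_trans _ _ (expR (3^-1) ^+ k.+1)%R).
    rewrite -expRM_natl ler_expR aE invfM mulrACA mulfV ?gt_eqF// mulr1.
    by rewrite ler_pdivrMr//; move: tk; lra.
  by rewrite ler_pXn2r// ?nnegrE ?expR_ge0// divr_ge0.
apply: (@le_trans _ _ (((3 / 2) ^+ k.+1)%:E)); first by rewrite lee_fin.
case: k => [|k] in tk kmin le_e *.
  rewrite expr1 -[leLHS]mule1 lee_pmul// lee_fin; lra.
apply: (@le_trans _ _ (2%:E * ((3 / 2) ^+ k.+1)%:E)).
  rewrite exprS -EFinM lee_fin ler_wpM2r ?exprn_ge0 ?divr_ge0//; lra.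
rewrite lee_wpmul2l// ?lee_fin//.
have := term_le k.+1; rewrite indicE mem_set ?mule1//.
exists (m - n)%N => //; rewrite /exceed /= subnKC// -/a aE ltr_pM2r//.
by rewrite ltNge; apply/negP => /kmin; rewrite ltnn.
Qed.

(** Take u^2 / 2 <= exp u at u = |g_m - g_{n-1}| / (9K): the constant is 2 * 9^2 <= 2^8, doubled by
    [expR_jn_weight]. *)
Lemma sqr_jn_weight n m x : (n <= m)%N ->
  ((g m x - lag g n x) ^+ 2)%:E <= (2 ^+ 9 * K ^+ 2)%:E * jn_weight n x.
Proof.
move=> nm; set a := `|g m x - lag g n x|%R.
have a0 : (0 <= a / (9 * K))%R by rewrite divr_ge0 ?normr_ge0// mulr_ge0// ltW.
have := expR_ge1Dxn 1 a0; rewrite -[(2)`!]/2%N => h.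
have {}h : (a ^+ 2 <= 2 ^+ 8 * K ^+ 2 * expR (a / (9 * K)))%R.
  have e0 := expR_ge0 (a / (9 * K)).
  apply: (@le_trans _ _ (9 ^+ 2 * 2 * K ^+ 2 * expR (a / (9 * K)))%R); last first.
    by rewrite ler_wpM2r// ler_wpM2r ?sqr_ge0//; lra.
  have -> : (a ^+ 2 = 9 ^+ 2 * 2 * K ^+ 2 * ((a / (9 * K)) ^+ 2 / 2))%R.
    by field; rewrite gt_eqF.
  by rewrite ler_wpM2l; [| |lra]; rewrite ?mulr_ge0 ?exprn_ge0 ?ler0n// ltW.
rewrite -[(_ ^+ 2)%R]real_normK ?num_real// -/a.
apply: (@le_trans _ _ ((2 ^+ 8 * K ^+ 2)%:E * (expR (a / (9 * K)))%:E)).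
  by rewrite -EFinM lee_fin.
have -> : (2 ^+ 9 * K ^+ 2 = 2 ^+ 8 * K ^+ 2 * 2)%R by ring.
rewrite [(2 ^+ 8 * K ^+ 2 * 2)%:E]EFinM -muleA lee_wpmul2l//; last exact: expR_jn_weight.
by rewrite lee_fin mulr_ge0 ?sqr_ge0// exprn_ge0.
Qed.

End john_nirenberg.

(** * Products with an almost surely bounded factor; exchange of a double sum *)

Section ae_bounded.
Context {d : measure_display} {T : measurableType d} {R : realType}.
Variables (P : probability T R).
Local Open Scope ereal_scope.

Lemma integral_indicM (A : set T) (f : T -> R) :
  \int[P]_(x in A) (f x)%:E = \int[P]_x (\1_A x * f x)%:E.
Proof.
rewrite integral_mkcond; apply: eq_integral => x _; rewrite /patch indicE.
by case: ifPn => xA; rewrite ?mul1r ?mul0r.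
Qed.

Lemma ae_bounded_integrable (X : T -> R) (c : R) :
  measurable_fun [set: T] X -> {ae P, forall x, (`|X x| <= c)%R} ->
  P.-integrable [set: T] (EFin \o X).
Proof. by move=> mX Xc; apply/Lfun1_integrable; exact: ae_bounded_Lfun mX Xc. Qed.

Lemma ae_bounded_integrableM (X Y : T -> R) (c : R) :
  measurable_fun [set: T] X -> {ae P, forall x, (`|X x| <= c)%R} ->
  P.-integrable [set: T] (EFin \o Y) ->
  P.-integrable [set: T] (fun x => (X x * Y x)%:E).
Proof.
move=> mX Xc iY.
have mY : measurable_fun [set: T] Y by apply/measurable_EFinP; exact: measurable_int iY.
apply/integrableP; split; first by apply/measurable_EFinP; exact: measurable_funM.
have icY : P.-integrable [set: T] (fun x => c%:E * `|(Y x)%:E|).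
  by apply: integrableZl => //; exact: (integrable_abse iY).
apply: (@le_lt_trans _ _ (\int[P]_x (`|c|%:E * `|(Y x)%:E|))).
  apply: ae_ge0_le_integral => //.
  - by apply/measurable_EFinP; apply: measurableT_comp => //; exact: measurable_funM.
  - by apply: measurable_funeM; apply/measurable_EFinP; exact: measurableT_comp.
  apply: filterS Xc => x Xxc _; rewrite /= -EFinM lee_fin normrM ler_wpM2r//.
  exact: le_trans (ler_norm _).
rewrite ge0_integralZl//; last by apply/measurable_EFinP; exact: measurableT_comp.
by rewrite lte_mul_pinfty//; case/integrableP: iY.
Qed.

End ae_bounded.

Lemma sum_triangle (R : nmodType) (u : nat -> nat -> R) n :
  \sum_(0 <= k < n.+1) \sum_(0 <= i < k.+1) u i k =
  \sum_(0 <= i < n.+1) \sum_(i <= k < n.+1) u i k.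
Proof.
elim: n => [|n ih]; first by rewrite !big_nat1.
rewrite big_nat_recr//= ih [in RHS]big_nat_recr//= big_nat1.
rewrite [X in _ + X = _]big_nat_recr//= addrA.
congr (_ + _); rewrite -big_split/=; apply: eq_big_nat => i /andP[_ ni].
by rewrite [in RHS]big_nat_recr// ltnW.
Qed.

(** * Fefferman's inequality and the weight of the first paraproduct *)

Section square_function.
Context {d : measure_display} {T : measurableType d} {R : realType}.
Variables (P : probability T R) (F : nat -> set (set T)).
Hypothesis hF : filtration F.
Local Open Scope ereal_scope.

Variables (g : process T R) (ginf : T -> R) (K : R).
Hypotheses (mg : martingale P F g) (iginf : P.-integrable [set: T] (EFin \o ginf)).
Hypotheses (gc : forall n, is_cexp P (F n) ginf (g n)) (K0 : (0 < K)%R).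
Hypothesis gK : forall n A, F n A ->
  \int[P]_(x in A) `|ginf x - lag g n x|%:E <= K%:E * P A.
Hypothesis lagK : forall n, {ae P, forall x, (`|lag g n x| <= n%:R * K)%R}.
Hypothesis mdiffK : forall n, {ae P, forall x, (`|mdiff n g x| <= K)%R}.

Let ag : adapted F g := martingale_adapted mg.

(** Orthogonality of increments: the cross term carries the [F (n + m)]-measurable weight formed
    with the indicator of [A], and [lagK] and [mdiffK] make every product integrable. The sum
    includes the jump at time [n], in accordance with the reference value [lag g n]. *)
Lemma integral_sum_mdiff_sqr n m A : F n A ->
  \int[P]_(x in A) (\sum_(n <= j < (n + m).+1) mdiff j g x ^+ 2)%:E =
  \int[P]_(x in A) ((g (n + m)%N x - lag g n x) ^+ 2)%:E.
Proof.
move=> FA; have mA := filtration_measurable hF FA.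
have mlag k : measurable_fun [set: T] (lag g k) by exact: (lag_measurable hF ag).
have mmd k : measurable_fun [set: T] (mdiff k g) by exact: (mdiff_measurable hF ag).
have md k : measurable_fun [set: T] (fun x => g k x - lag g n x)%R.
  by apply: measurable_funB => //; exact: (adapted_measurable hF ag).
have bd k : {ae P, forall x, (`|g k x - lag g n x| <= (k.+1 + n)%:R * K)%R}.
  apply: filterS2 (lagK k.+1) (lagK n) => x h1 h2.
  by rewrite (le_trans (ler_normB _ _))// natrD mulrDl lerD.
have i2 k : P.-integrable [set: T] (fun x => ((g k x - lag g n x) ^+ 2)%:E).
  under eq_fun do rewrite expr2.
  by apply: ae_bounded_integrableM (bd k) _ => //; exact: ae_bounded_integrable (bd k).
have id k : P.-integrable [set: T] (fun x => (mdiff k g x ^+ 2)%:E).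
  under eq_fun do rewrite expr2.
  apply: ae_bounded_integrableM (mdiffK k) _ => //; exact: ae_bounded_integrable (mdiffK k).
have ix k : P.-integrable [set: T] (fun x => ((g k x - lag g n x) * mdiff k.+1 g x)%:E).
  by apply: ae_bounded_integrableM (bd k) _ => //; exact: ae_bounded_integrable (mdiffK k.+1).
have iA (f : T -> \bar R) : P.-integrable [set: T] f -> P.-integrable A f.
  by move=> i; exact: integrableS i.
elim: m => [|m ih].
  by rewrite addn0; apply: eq_integral => x _; rewrite big_nat1.
rewrite addnS.
have iS k : P.-integrable [set: T] (fun x => (\sum_(n <= j < k) mdiff j g x ^+ 2)%:E).
  by under eq_fun do rewrite -sumEFin; exact: integrable_sum.
transitivity (\int[P]_(x in A) ((\sum_(n <= j < (n + m).+1) mdiff j g x ^+ 2)%:E +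
   (mdiff (n + m).+1 g x ^+ 2)%:E)).
  by apply: eq_integral => x _; rewrite big_nat_recr//= ltnW// ltnS leq_addr.
rewrite integralD//; [|exact: iA..].
rewrite ih.
transitivity (\int[P]_(x in A) (((g (n + m)%N x - lag g n x) ^+ 2)%:E +
   (mdiff (n + m).+1 g x ^+ 2)%:E +
   2%:E * ((g (n + m)%N x - lag g n x) * mdiff (n + m).+1 g x)%:E)); last first.
  apply: eq_integral => x _; rewrite -EFinM -!EFinD mdiffS; congr EFin; ring.
have ix2 : P.-integrable [set: T] (fun x =>
    2%:E * ((g (n + m)%N x - lag g n x) * mdiff (n + m).+1 g x)%:E).
  exact: integrableZl.
rewrite integralD//; [|exact/iA/integrableD|exact: iA].
rewrite integralD//; [|exact: iA..].
rewrite integralZl//; last exact: iA.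
rewrite [X in _ = _ + _ * X]integral_indicM.
under [X in _ = _ + _ * X]eq_integral do rewrite mulrA.
rewrite (integral_mdiff_weight0 hF mg) ?mule0 ?adde0//.
  apply: measurable_funM.
    apply: measurable_indic; apply: (measurable_sub (filtration_sigma hF _)).
    exact: (filtration_le hF (leq_addr _ _) FA).
  apply: measurable_funB; first exact: (@ag (n + m)%N).
  by apply: (lag_adapted hF ag); rewrite leqW// leq_addr.
under eq_fun do rewrite -mulrA.
apply: (@ae_bounded_integrableM _ _ _ _ _ _ 1%R) => //.
  by apply: nearW => x; rewrite indicE; case: (_ \in _); rewrite ?normr1 ?normr0.
exact: ix.
Qed.

(** This is the BMO_2 property expressed by increments; the constant comes from 2^9 * 5 <= 2^12. *)
Lemma integral_sum_mdiff_sqr_le n N A : F n A ->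
  \int[P]_(x in A) (\sum_(n <= j < N.+1) mdiff j g x ^+ 2)%:E <=
  (2 ^+ 12 * K ^+ 2)%:E * P A.
Proof.
move=> FA; have mA := filtration_measurable hF FA.
have [Nn|nN] := ltnP N n.
  under eq_integral do rewrite big_geq//.
  by rewrite integral0 mule_ge0// lee_fin mulr_ge0// sqr_ge0.
rewrite -(subnKC nN) integral_sum_mdiff_sqr//.
have mlag k : measurable_fun [set: T] (lag g k) by exact: (lag_measurable hF ag).
have mW := @measurable_jn_weight _ _ _ P F hF g K mg n.
have W0 := jn_weight_ge0 g K n.
apply: (@le_trans _ _ (\int[P]_(x in A) ((2 ^+ 9 * K ^+ 2)%:E * jn_weight g K n x))).
  apply: ge0_le_integral => //.
  - by move=> x _; rewrite lee_fin sqr_ge0.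
  - apply: measurable_funTS; apply/measurable_EFinP; apply: measurable_funX.
    by apply: measurable_funB => //; exact: (adapted_measurable hF ag).
  - by apply: measurable_funTS; exact: measurable_funeM.
  - by move=> x _; apply: sqr_jn_weight => //; rewrite leq_addr.
have c0 : 0 <= (2 ^+ 9 * K ^+ 2)%:E by rewrite lee_fin mulr_ge0 ?sqr_ge0// exprn_ge0.
rewrite ge0_integralZl//; last exact: measurable_funTS.
apply: le_trans (lee_wpmul2l c0 (integral_jn_weight hF mg iginf gc K0 gK FA)) _.
rewrite muleA -EFinM lee_wpmul2r// lee_fin mulrAC ler_wpM2r ?sqr_ge0//; lra.
Qed.

(** Summation by parts: once a_k is the sum of its nonnegative increments, the [F i]-measurable d_i
    a multiplies the sum of |d_j g|^2 over j >= i, and [le_integral_weight] compares that tail with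
    a constant. It is applied to the square function of f and to the lagged maximal function of
    f. *)
Lemma integral_weighted_mdiff_sqr (a : process T R) N : adapted F a ->
  (forall n x, (0 <= mdiff n a x)%R) ->
  \int[P]_x (\sum_(0 <= k < N.+1) a k x * mdiff k g x ^+ 2)%:E <=
  (2 ^+ 12 * K ^+ 2)%:E * \int[P]_x (a N x)%:E.
Proof.
move=> aa a0.
have aE n x : a n x = (\sum_(0 <= k < n.+1) mdiff k a x)%R.
  elim: n => [|n ih]; first by rewrite big_nat1 /mdiff subr0.
  by rewrite big_nat_recr//= -ih mdiffS subrKC.
pose Z k x := (\sum_(k <= j < N.+1) mdiff j g x ^+ 2)%R.
have mZ k : measurable_fun [set: T] (Z k).
  by apply: measurable_fun_sumr => j _; apply: measurable_funX; exact: (mdiff_measurable hF ag).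
have Z0 k x : (0 <= Z k x)%R by rewrite sumr_ge0// => j _; exact: sqr_ge0.
have mda k : measurable_fun [set: T] (mdiff k a) by exact: (mdiff_measurable hF aa).
under eq_integral => x _.
  rewrite (_ : (\sum_(0 <= k < N.+1) a k x * mdiff k g x ^+ 2 =
     \sum_(0 <= k < N.+1) mdiff k a x * Z k x)%R); last first.
    under eq_bigr do rewrite aE mulr_suml.
    under [RHS]eq_bigr do rewrite mulr_sumr.
    exact: sum_triangle.
  rewrite -sumEFin.
  over.
rewrite ge0_integral_sum//; last 2 first.
  by move=> k; apply/measurable_EFinP; exact: measurable_funM.
  by move=> k x _; rewrite lee_fin mulr_ge0.
under [in leRHS]eq_integral do rewrite aE -sumEFin.
rewrite [in leRHS]ge0_integral_sum//; last 2 first.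
  by move=> k; apply/measurable_EFinP.
  by move=> k x _; rewrite lee_fin.
rewrite ge0_sume_distrr; last by move=> k _; apply: integral_ge0 => x _; rewrite lee_fin.
apply: lee_sum => k _.
apply: (@le_trans _ _ (\int[P]_x (mdiff k a x * (2 ^+ 12 * K ^+ 2))%:E)).
  apply: (le_integral_weight (filtration_sigma hF k) (@filtration_measurable _ _ _ hF k)) => //.
  - by move=> x; rewrite mulr_ge0// sqr_ge0.
  - move=> A FA; rewrite integral_cst; first exact: integral_sum_mdiff_sqr_le.
    exact: (filtration_measurable hF FA).
  - exact: (@mdiff_adapted _ _ _ F hF a aa k k (leqnn k)).
under [in leLHS]eq_integral do rewrite mulrC EFinM.
rewrite ge0_integralZl//.
- exact/measurable_EFinP.
- by move=> x _; rewrite lee_fin.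
- by rewrite lee_fin mulr_ge0 ?sqr_ge0// exprn_ge0.
Qed.

Variables (f : process T R).
Hypothesis mf : martingale P F f.
Let af : adapted F f := martingale_adapted mf.

Let mS n : measurable_fun [set: T] (sqpart f n).
Proof. exact: (measurable_fun_filtration hF (@sqpart_adapted _ _ _ _ hF f af n)). Qed.

Let mM n : measurable_fun [set: T] (maxpart f n).
Proof. exact: (measurable_fun_filtration hF (@maxpart_adapted _ _ _ _ hF f af n)). Qed.

Let mdf n : measurable_fun [set: T] (mdiff n f).
Proof. exact: (mdiff_measurable hF af). Qed.

Let mdg n : measurable_fun [set: T] (mdiff n g).
Proof. exact: (mdiff_measurable hF ag). Qed.

(** Each product is split with weight [sqpart f k]: the [f] half telescopes by
    [sum_mdiff_div_sqpart], and the [g] half is a weighted sum with a nondecreasing adapted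
    weight. *)
Lemma fefferman_inequality N :
  \int[P]_x (\sum_(0 <= k < N.+1) `|mdiff k f x * mdiff k g x|)%:E <=
  (2 ^+ 12 * K)%:E * \int[P]_x (sqpart f N x)%:E.
Proof.
have S0 x : (0 <= sqpart f N x)%R := sqpart_ge0 f N x.
pose V x := (\sum_(0 <= k < N.+1) sqpart f k x * mdiff k g x ^+ 2)%R.
have V0 x : (0 <= V x)%R.
  by rewrite sumr_ge0// => k _; rewrite mulr_ge0 ?sqr_ge0 ?sqpart_ge0.
have mV : measurable_fun [set: T] V.
  apply: measurable_fun_sumr => k _; apply: measurable_funM => //.
  exact: measurable_funX.
have VS : \int[P]_x (V x)%:E <= (2 ^+ 12 * K ^+ 2)%:E * \int[P]_x (sqpart f N x)%:E.
  apply: integral_weighted_mdiff_sqr; first exact: sqpart_adapted.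
  by case=> [|n] x; rewrite ?mdiffS /mdiff ?subr0 ?subr_ge0 ?sqpart_ge0// sqpart_nd.
(* AM-GM with weight [K / sqpart f k]; if [sqpart f k x = 0] then [mdiff k f x = 0]. *)
have pointwise x : (\sum_(0 <= k < N.+1) `|mdiff k f x * mdiff k g x| <=
    K * sqpart f N x + (2 * K)^-1 * V x)%R.
  have term k : (`|mdiff k f x * mdiff k g x| <=
      K / 2 * (mdiff k f x ^+ 2 / sqpart f k x) +
      (2 * K)^-1 * (sqpart f k x * mdiff k g x ^+ 2))%R.
    have fs : (`|mdiff k f x| <= sqpart f k x)%R.
      rewrite -(@ler_pXn2r _ 2) ?nnegrE ?sqpart_ge0// real_normK ?num_real// sqr_sqpart.
      by rewrite big_nat_recr//= lerDr sumr_ge0// => i _; exact: sqr_ge0.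
    have := sqpart_ge0 f k x; rewrite le_eqVlt => /predU1P[s0|s0].
      move: fs; rewrite -s0 normr_le0 => /eqP ->.
      by rewrite !mul0r normr0 mulr0 expr0n !mul0r mulr0 addr0.
    rewrite -[(mdiff k f x ^+ 2)%R]real_normK ?num_real//.
    rewrite -[(mdiff k g x ^+ 2)%R]real_normK ?num_real// normrM.
    move: s0; set s := sqpart f k x; set u := `|_|%R; set v := `|_|%R => s0.
    rewrite -subr_ge0.
    have -> : (K / 2 * (u ^+ 2 / s) + (2 * K)^-1 * (s * v ^+ 2) - u * v =
       (K * u - s * v) ^+ 2 / (2 * K * s))%R.
      by field; rewrite !gt_eqF.
    by rewrite divr_ge0 ?sqr_ge0// !mulr_ge0// ltW.
  apply: le_trans (ler_sum _ (fun k _ => term k)) _.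
  rewrite big_split/= -!mulr_sumr lerD2r.
  have := sum_mdiff_div_sqpart f N x; have := K0; nra.
apply: (@le_trans _ _ (\int[P]_x (K%:E * (sqpart f N x)%:E + ((2 * K)^-1)%:E * (V x)%:E))).
  apply: ge0_le_integral => //.
  - by move=> x _; rewrite lee_fin sumr_ge0.
  - apply/measurable_EFinP; apply: measurable_fun_sumr => k _.
    by apply: measurableT_comp => //; exact: measurable_funM.
  - by apply: emeasurable_funD; apply: measurable_funeM; exact/measurable_EFinP.
  - by move=> x _; rewrite -!EFinM -EFinD lee_fin.
have K0e : (0 <= K)%R by exact: ltW.
have K2e : (0 <= (2 * K)^-1)%R by rewrite invr_ge0 mulr_ge0.
have mSe : measurable_fun [set: T] (fun x => (sqpart f N x)%:E) by exact/measurable_EFinP.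
have mVe : measurable_fun [set: T] (fun x => (V x)%:E) by exact/measurable_EFinP.
rewrite ge0_integralD//; last 4 first.
- by move=> x _; rewrite mule_ge0 ?lee_fin.
- exact: measurable_funeM.
- by move=> x _; rewrite mule_ge0 ?lee_fin.
- exact: measurable_funeM.
rewrite !ge0_integralZl ?lee_fin//; [|by move=> x _; rewrite lee_fin..].
apply: (@le_trans _ _ (K%:E * \int[P]_x (sqpart f N x)%:E +
    (2 * K)^-1%:E * ((2 ^+ 12 * K ^+ 2)%:E * \int[P]_x (sqpart f N x)%:E))).
  by rewrite leeD2l// lee_wpmul2l// lee_fin.
rewrite muleA -EFinM -ge0_muleDl ?lee_fin ?mulr_ge0 ?sqr_ge0// -EFinD.
rewrite lee_wpmul2r ?lee_fin//; first by apply: integral_ge0 => x _; rewrite lee_fin.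
rewrite (_ : K + _ = (1 + 2 ^+ 11) * K)%R; last by field; rewrite gt_eqF.
by rewrite ler_wpM2r//; lra.
Qed.

(** The integrand is the AM-GM majorant of the root of [maxpart f N] times the weighted sum. With
    Davis' constant the factor is (1 + 2^12) * 24 <= 2^17. *)
Lemma paraproduct_weight_bound N :
  \int[P]_x (K * maxpart f N x + K^-1 *
    \sum_(0 <= k < N.+1) lag (maxpart f) k x * mdiff k g x ^+ 2)%:E
  <= (2 ^+ 17 * K)%:E * \int[P]_x (sqpart f N x)%:E.
Proof.
pose V x := (\sum_(0 <= k < N.+1) lag (maxpart f) k x * mdiff k g x ^+ 2)%R.
rewrite (_ : \int[P]_x _ = \int[P]_x (K * maxpart f N x + K^-1 * V x)%:E)//.
have lagM0 k x : (0 <= lag (maxpart f) k x)%R by case: k => //= k; exact: maxpart_ge0.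
have aM := @maxpart_adapted _ _ _ _ hF f af.
have V0 x : (0 <= V x)%R.
  by rewrite sumr_ge0// => k _; rewrite mulr_ge0 ?sqr_ge0.
have mV : measurable_fun [set: T] V.
  apply: measurable_fun_sumr => k _; apply: measurable_funM.
    exact: (lag_measurable hF aM).
  exact: measurable_funX.
have M0 x := maxpart_ge0 f N x.
have VM : \int[P]_x (V x)%:E <= (2 ^+ 12 * K ^+ 2)%:E * \int[P]_x (maxpart f N x)%:E.
  apply: le_trans (integral_weighted_mdiff_sqr N _ _) _.
  - by move=> n; apply: (lag_adapted hF aM).
  - move=> [|[|n]] x; rewrite /mdiff /= ?subr0 ?maxpart_ge0// subr_ge0.
    exact: (maxpart_nd f x (leqnSn n)).
  apply: lee_wpmul2l; first by rewrite lee_fin mulr_ge0 ?sqr_ge0// exprn_ge0.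
  apply: ge0_le_integral => //.
  - by move=> x _; rewrite lee_fin.
  - by apply/measurable_EFinP; exact: (lag_measurable hF aM).
  - exact/measurable_EFinP.
  - move=> x _; rewrite lee_fin; case: (N) => [|n] /=; first exact: normr_ge0.
    exact: (maxpart_nd f x (leqnSn n)).
have K0e : (0 <= K)%R by exact: ltW.
have Ki : (0 <= K^-1)%R by rewrite invr_ge0.
have mMe : measurable_fun [set: T] (fun x => (maxpart f N x)%:E) by exact/measurable_EFinP.
have mVe : measurable_fun [set: T] (fun x => (V x)%:E) by exact/measurable_EFinP.
under eq_integral do rewrite EFinD !EFinM.
rewrite ge0_integralD//; last 4 first.
- by move=> x _; rewrite mule_ge0 ?lee_fin.
- exact: measurable_funeM.
- by move=> x _; rewrite mule_ge0 ?lee_fin.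
- exact: measurable_funeM.
rewrite !ge0_integralZl ?lee_fin//; [|by move=> x _; rewrite lee_fin..].
apply: (@le_trans _ _ (K%:E * \int[P]_x (maxpart f N x)%:E +
    K^-1%:E * ((2 ^+ 12 * K ^+ 2)%:E * \int[P]_x (maxpart f N x)%:E))).
  by rewrite leeD2l// lee_wpmul2l// lee_fin.
rewrite muleA -EFinM -ge0_muleDl ?lee_fin ?mulr_ge0 ?sqr_ge0// -EFinD.
rewrite (_ : K + _ = (1 + 2 ^+ 12) * K)%R; last by field; rewrite gt_eqF.
have c0 : 0 <= ((1 + 2 ^+ 12) * K)%:E by rewrite lee_fin mulr_ge0// addr_ge0// exprn_ge0.
apply: le_trans (lee_wpmul2l c0 (davis_inequality hF mf N)) _.
rewrite muleA -EFinM lee_wpmul2r// ?lee_fin.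
  by apply: integral_ge0 => x _; rewrite lee_fin sqpart_ge0.
by rewrite mulrAC ler_wpM2r//; lra.
Qed.

End square_function.

(** * The function t / log (e + t) *)

Section orlicz_function.
Context {R : realType}.
Implicit Types s t q : R.

Definition philog t : R := t / ln (expR 1 + t).

Lemma ln_expR1D_ge1 t : 0 <= t -> 1 <= ln (expR 1 + t).
Proof.
move=> t0; rewrite -{1}(expRK (1 : R)) ler_ln ?posrE ?expR_gt0 ?lerDl//.
by rewrite ltr_wpDr ?expR_gt0.
Qed.

Let ln_gt0 t : 0 <= t -> 0 < ln (expR 1 + t).
Proof. by move=> /ln_expR1D_ge1; apply: lt_le_trans. Qed.

Lemma philog_ge0 t : 0 <= t -> 0 <= philog t.
Proof. by move=> t0; rewrite divr_ge0// ltW// ln_gt0. Qed.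

Lemma philog_le t : 0 <= t -> philog t <= t.
Proof. by move=> t0; rewrite ler_pdivrMr ?ln_gt0// ler_peMr// ln_expR1D_ge1. Qed.

(** From ln (1 + x) <= x one gets s ln (e + t) <= s ln (e + s) + (t - s), and the last difference is
    at most (t - s) ln (e + s) because that logarithm is at least 1. *)
Lemma philog_nd s t : 0 <= s -> s <= t -> philog s <= philog t.
Proof.
move=> s0 st; have t0 := le_trans s0 st.
rewrite ler_pdivrMr ?ln_gt0// mulrAC ler_pdivlMr ?ln_gt0//.
have es0 : 0 < expR 1 + s by rewrite ltr_wpDr ?expR_gt0.
have et0 : 0 < expR 1 + t by rewrite ltr_wpDr ?expR_gt0.
have h : ln (expR 1 + t) <= ln (expR 1 + s) + (t - s) / (expR 1 + s).
  have -> : expR 1 + t = (expR 1 + s) * (1 + (t - s) / (expR 1 + s)).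
    by field; rewrite gt_eqF.
  have x0 : 0 <= (t - s) / (expR 1 + s) by rewrite divr_ge0 ?subr_ge0// ltW.
  by rewrite lnM ?posrE ?ltr_wpDr// lerD2l le_ln1Dx// (lt_le_trans _ x0)// ltrN10.
apply: (le_trans (ler_wpM2l s0 h)); rewrite mulrDr.
have h2 : s * ((t - s) / (expR 1 + s)) <= t - s.
  rewrite mulrCA ler_piMr ?subr_ge0// ler_pdivrMr// mul1r lerDr expR_ge0//.
have := ln_expR1D_ge1 s0; have : 0 <= t - s by rewrite subr_ge0.
nra.
Qed.

Lemma philog_max2 s t : 0 <= s -> 0 <= t -> philog (s + t) <= philog (2 * s) + philog (2 * t).
Proof.
move=> s0 t0; have [st|ts] := leP s t.
  apply: (@le_trans _ _ (philog (2 * t))).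
    by apply: philog_nd; rewrite ?addr_ge0//; lra.
  by rewrite lerDr philog_ge0// mulr_ge0.
apply: (@le_trans _ _ (philog (2 * s))).
  by apply: philog_nd; rewrite ?addr_ge0//; lra.
by rewrite lerDl philog_ge0// mulr_ge0.
Qed.

(* With [t = dl * q], either [t <= 2 ln (e + s)], or [s <= e^(t/2)]. *)
Lemma philog_mul_expR s q dl : 0 <= s -> 0 <= q -> 0 <= dl <= 1 ->
  philog (s * (dl * q)) <= 2 * s + 2 * dl * expR q.
Proof.
move=> s0 q0 /andP[d0 d1]; set t := dl * q.
have t0 : 0 <= t by rewrite mulr_ge0.
have st0 : 0 <= s * t by rewrite mulr_ge0.
have e0 : 0 <= 2 * dl * expR q by rewrite !mulr_ge0// expR_ge0.
have [tl|lt_] := leP t (2 * ln (expR 1 + s)).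
  apply: (@le_trans _ _ (2 * s)); last by rewrite lerDl.
  have [t1|t1] := leP t 1.
    apply: (le_trans (philog_le st0)); nra.
  rewrite ler_pdivrMr ?ln_gt0//.
  have : ln (expR 1 + s) <= ln (expR 1 + s * t).
    rewrite ler_ln ?posrE ?ltr_wpDr ?expR_gt0// lerD2l ler_peMr// ltW//.
  nra.
apply: (le_trans (philog_le st0)); apply: (@le_trans _ _ (2 * dl * expR q)); last first.
  by rewrite lerDr mulr_ge0.
have es0 : 0 < expR 1 + s by rewrite ltr_wpDr ?expR_gt0.
have s_le : s <= expR (q / 2).
  apply: (@le_trans _ _ (expR 1 + s)); first by rewrite lerDr expR_ge0.
  rewrite -[leLHS]lnK ?posrE// ler_expR.
  have : t <= q by rewrite ler_piMl.
  lra.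
have q_le : q <= 2 * expR (q / 2) by have := expR_ge1Dx (q / 2); lra.
have -> : expR q = expR (q / 2) * expR (q / 2) by rewrite -expRD -splitr.
have := expR_ge0 (q / 2); rewrite /t => e2.
have : s * q <= expR (q / 2) * (2 * expR (q / 2)) by exact: ler_pM.
nra.
Qed.

End orlicz_function.

(** * The diagonal part and the paraproducts *)

Section product_decomposition.
Context {d : measure_display} {T : measurableType d} {R : realType}.
Implicit Types (f g : process T R) (x : T).

Definition diag_part f g : process T R :=
  fun n x => \sum_(0 <= k < n.+1) mdiff k f x * mdiff k g x.

(** Taken as the remainder, so that the decomposition holds at every point and bilinearity is pure
    algebra; [mdiff_para_part] recovers the two paraproducts. *)
Definition para_part f g : process T R := fun n x => f n x * g n x - diag_part f g n x.

Lemma mdiff_diag_part f g n x : mdiff n (diag_part f g) x = mdiff n f x * mdiff n g x.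
Proof.
case: n => [|n]; first by rewrite {1}/mdiff /= /diag_part big_nat1 subr0.
by rewrite mdiffS /diag_part big_nat_recr//= addrAC subrr add0r.
Qed.

Lemma mdiff_para_part f g n x :
  mdiff n (para_part f g) x = lag f n x * mdiff n g x + lag g n x * mdiff n f x.
Proof.
case: n => [|n].
  by rewrite /mdiff /= /para_part /diag_part big_nat1 /mdiff /=; ring.
have := mdiff_diag_part f g n.+1 x; rewrite !mdiffS /para_part /= => h.
have -> : diag_part f g n.+1 x = diag_part f g n x + (f n.+1 x - f n x) * (g n.+1 x - g n x).
  by rewrite -h subrKC.
by ring.
Qed.

Lemma mdiff_linear a f f' n x :
  mdiff n (fun n x => a * f n x + f' n x) x = a * mdiff n f x + mdiff n f' x.
Proof. by case: n => [|n]; rewrite /mdiff /=; ring. Qed.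

Lemma diag_part_linearl a f f' g :
  diag_part (fun n x => a * f n x + f' n x) g =
  (fun n x => a * diag_part f g n x + diag_part f' g n x).
Proof.
apply/funext => n; apply/funext => x; rewrite /diag_part mulr_sumr -big_split/=.
by apply: eq_bigr => k _; rewrite mdiff_linear mulrDl mulrA.
Qed.

Lemma diag_part_linearr a f g g' :
  diag_part f (fun n x => a * g n x + g' n x) =
  (fun n x => a * diag_part f g n x + diag_part f g' n x).
Proof.
apply/funext => n; apply/funext => x; rewrite /diag_part mulr_sumr -big_split/=.
by apply: eq_bigr => k _; rewrite mdiff_linear; ring.
Qed.

Lemma para_part_linearl a f f' g :
  para_part (fun n x => a * f n x + f' n x) g =
  (fun n x => a * para_part f g n x + para_part f' g n x).
Proof.
by apply/funext => n; apply/funext => x; rewrite /para_part diag_part_linearl; ring.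
Qed.

Lemma para_part_linearr a f g g' :
  para_part f (fun n x => a * g n x + g' n x) =
  (fun n x => a * para_part f g n x + para_part f g' n x).
Proof.
by apply/funext => n; apply/funext => x; rewrite /para_part diag_part_linearr; ring.
Qed.

(* [`|lag f k|^2 <= maxpart f N * lag (maxpart f) k], and the first factor is separated from
   the sum by AM-GM with weight [K]. *)
Lemma sqpart_para_part_le f g N x (K u y s : R) : 0 < K -> 0 <= y ->
  K * maxpart f N x +
    K^-1 * (\sum_(0 <= k < N.+1) lag (maxpart f) k x * mdiff k g x ^+ 2) <= u ->
  (forall k, `|lag g k x| <= y) -> sqpart f N x <= s ->
  sqpart (para_part f g) N x <= u + 2 * (y * s).
Proof.
move=> K0 y0 Vu gy fs.
set V := \sum_(0 <= k < N.+1) _ in Vu.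
have lagM0 k : 0 <= lag (maxpart f) k x by case: k => //= k; exact: maxpart_ge0.
have V0 : 0 <= V by rewrite sumr_ge0// => k _; rewrite mulr_ge0 ?sqr_ge0.
have M0 := maxpart_ge0 f N x; have S0 := sqpart_ge0 f N x.
have s0 : 0 <= s := le_trans S0 fs.
have KM0 : 0 <= K * maxpart f N x by rewrite mulr_ge0// ltW.
have KV0 : 0 <= K^-1 * V by rewrite mulr_ge0// invr_ge0 ltW.
have u0 : 0 <= u by apply: le_trans Vu; rewrite addr_ge0.
have ys0 : 0 <= y * s by rewrite mulr_ge0.
rewrite -(@ler_pXn2r _ 2) ?nnegrE ?sqpart_ge0 ?addr_ge0 ?mulr_ge0//.
rewrite sqr_sqpart.
have term k : (k < N.+1)%N -> mdiff k (para_part f g) x ^+ 2 <=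
    2 * maxpart f N x * (lag (maxpart f) k x * mdiff k g x ^+ 2) +
    2 * y ^+ 2 * mdiff k f x ^+ 2.
  move=> kN; rewrite mdiff_para_part.
  have lagfM : lag f k x ^+ 2 <= maxpart f N x * lag (maxpart f) k x.
    case: k kN => [|k] kN /=; first by rewrite expr0n mulr0.
    rewrite -real_normK ?num_real// expr2 ler_pM// ?le_maxpart//.
    apply: le_trans (le_maxpart f k x) _; apply: maxpart_nd; exact: ltnW.
  have laggy : lag g k x ^+ 2 <= y ^+ 2.
    by rewrite -real_normK ?num_real// ler_pXn2r ?nnegrE// normr_ge0.
  have h1 : lag f k x ^+ 2 * mdiff k g x ^+ 2 <=
      maxpart f N x * lag (maxpart f) k x * mdiff k g x ^+ 2.
    by rewrite ler_wpM2r ?sqr_ge0.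
  have h2 : lag g k x ^+ 2 * mdiff k f x ^+ 2 <= y ^+ 2 * mdiff k f x ^+ 2.
    by rewrite ler_wpM2r ?sqr_ge0.
  have := sqr_ge0 (lag f k x * mdiff k g x - lag g k x * mdiff k f x).
  nra.
apply: (@le_trans _ _ (2 * maxpart f N x * V + 2 * y ^+ 2 * sqpart f N x ^+ 2)).
  rewrite sqr_sqpart !mulr_sumr -big_split/=.
  by apply: ler_sum_nat => k kN; exact: term.
have h3 : maxpart f N x * V = (K * maxpart f N x) * (K^-1 * V).
  by field; rewrite gt_eqF.
have h4 : sqpart f N x ^+ 2 <= s ^+ 2 by rewrite ler_pXn2r ?nnegrE.
have h5 : y ^+ 2 * sqpart f N x ^+ 2 <= (y * s) ^+ 2.
  by rewrite exprMn ler_wpM2l ?sqr_ge0.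
rewrite -!mulrA h3.
move: Vu KM0 KV0 h5; set p := K * maxpart f N x; set q := K^-1 * V.
set w := y * s in ys0 *; move=> Vu p0 q0 h5.
have : (p + q) ^+ 2 <= u ^+ 2 by rewrite ler_pXn2r ?nnegrE ?addr_ge0.
have : 0 <= u * w by rewrite mulr_ge0.
nra.
Qed.

End product_decomposition.

(** * The extended-valued square function and its truncations *)

Section sqfun_sqpart.
Context {d : measure_display} {T : measurableType d} {R : realType}.
Implicit Types (f : process T R) (x : T).
Local Open Scope ereal_scope.

Lemma sqfun_ge0 f x : 0 <= sqfun f x.
Proof. exact: poweR_ge0. Qed.

Let terms_ge0 f x n : 0 <= (`|mdiff n f x| ^+ 2)%:E :> \bar R.
Proof. by rewrite lee_fin exprn_ge0. Qed.

Lemma sqpart_sqr_sum f n x :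
  \sum_(0 <= k < n.+1) (`|mdiff k f x| ^+ 2)%:E = (sqpart f n x ^+ 2)%:E.
Proof.
rewrite sqr_sqpart -sumEFin; apply: eq_bigr => k _.
by rewrite real_normK ?num_real.
Qed.

Lemma sqpart_le_sqfun f n x : (sqpart f n x)%:E <= sqfun f x.
Proof.
rewrite -[sqpart f n x]ger0_norm ?sqpart_ge0// -sqrtr_sqr -powR12_sqrt ?sqr_ge0//.
rewrite -poweR_EFin; apply: gt0_ler_poweR.
- by rewrite invr_ge0.
- by rewrite in_itv/= leey lee_fin sqr_ge0.
- by rewrite in_itv/= leey andbT nneseries_ge0.
rewrite -sqpart_sqr_sum; apply: nneseries_lim_ge => k _ _; exact: terms_ge0.
Qed.

Lemma sqfun_le f x (c : R) : (0 <= c)%R -> (forall n, sqpart f n x <= c)%R ->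
  sqfun f x <= c%:E.
Proof.
move=> c0 fc.
have -> : c%:E = (c ^+ 2)%:E `^ 2^-1.
  by rewrite poweR_EFin powR12_sqrt ?sqr_ge0// sqrtr_sqr ger0_norm.
apply: gt0_ler_poweR.
- by rewrite invr_ge0.
- by rewrite in_itv/= leey andbT nneseries_ge0.
- by rewrite in_itv/= leey lee_fin sqr_ge0.
apply: lime_le; first by apply: is_cvg_nneseries => n _ _; exact: terms_ge0.
apply: nearW => -[|n]; first by rewrite big_geq// lee_fin sqr_ge0.
by rewrite sqpart_sqr_sum lee_fin ler_pXn2r ?nnegrE ?sqpart_ge0.
Qed.

Lemma measurable_sqfun f : (forall n, measurable_fun [set: T] (mdiff n f)) ->
  measurable_fun [set: T] (sqfun f).
Proof.
move=> mf; apply: (measurableT_comp (measurable_poweR _)).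
apply: ge0_emeasurable_sum => [n x _ _|n _]; first exact: terms_ge0.
by apply/measurable_EFinP; apply: measurable_funX; exact: measurableT_comp.
Qed.

Lemma H1_normE (P : probability T R) f : H1_norm P f = \int[P]_x sqfun f x.
Proof.
by rewrite /H1_norm Lnorm1; apply: eq_integral => x _; rewrite gee0_abs// sqfun_ge0.
Qed.

End sqfun_sqpart.

(** * Comparison of integrals, and passage from strict bounds to norms *)

Section ereal_bounds.
Context {d : measure_display} {T : measurableType d} {R : realType}.
Local Open Scope ereal_scope.

(* Unlike [ge0_le_integral], no measurability is required: the integral of a nonnegative
   function is a supremum over simple functions. *)
Lemma ge0_le_integral_nomeas (mu : {measure set T -> \bar R}) (f1 f2 : T -> \bar R) :
  (forall x, 0 <= f1 x) -> (forall x, f1 x <= f2 x) ->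
  \int[mu]_x f1 x <= \int[mu]_x f2 x.
Proof.
move=> f10 f12; have f20 x := le_trans (f10 x) (f12 x).
rewrite !ge0_integralTE//; apply: le_ereal_sup => _ [h hf <-]; exists h => //= x.
exact: le_trans (f12 x).
Qed.

(** For [e' <= 1], (r + e')(s + e') exceeds r s by at most e'(r + s + 1); [D] is [C] times this last
    factor, plus 1 to be positive. No normalisation is made, so [r] or [s] may vanish. *)
Lemma le_muleM_of_lt (C : R) (N r s : \bar R) : (0 <= C)%R ->
  0 <= r -> r < +oo -> 0 <= s -> s < +oo ->
  (forall a b : R, r < a%:E -> s < b%:E -> N <= (C * a * b)%:E) ->
  N <= C%:E * r * s.
Proof.
move=> C0; case: r => // r; case: s => // s; rewrite !lee_fin => r0 _ s0 _ h.
rewrite -!EFinM; apply/lee_addgt0Pr => e e0.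
pose D : R := (C * (r + s + 1) + 1)%R.
have D0 : (0 < D)%R by rewrite ltr_wpDl// mulr_ge0// !addr_ge0.
pose e' : R := Num.min 1%R (e / D)%R.
have e'0 : (0 < e')%R by rewrite lt_min ltr01 divr_gt0.
have e'1 : (e' <= 1)%R by rewrite ge_min lexx.
have e'D : (e' * D <= e)%R by rewrite -ler_pdivlMr// ge_min lexx orbT.
apply: (le_trans (h (r + e')%R (s + e')%R _ _)); rewrite ?lte_fin ?ltrDl//.
rewrite -EFinD lee_fin.
have : (C * e' * e' <= C * e')%R by rewrite ler_piMr// mulr_ge0// ltW.
move: e'D; rewrite /D; nra.
Qed.

End ereal_bounds.

(** * Boundedness of the two operators *)

Section bounds.
Context {d : measure_display} {T : measurableType d} {R : realType}.
Variables (P : probability T R) (F : nat -> set (set T)).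
Hypothesis hF : filtration F.
Local Open Scope ereal_scope.

Lemma H1_norm_ge0 f : 0 <= H1_norm P f :> \bar R.
Proof. exact: Lnorm_ge0. Qed.

Lemma BMO_norm_ge0 p g : 0 <= BMO_norm P F p g.
Proof.
apply: ereal_sup_ge; eexists; first by exists 0%N.
exact: poweR_ge0.
Qed.

Variables (p a b : R) (f g : process T R).
Hypotheses (p1 : (1 <= p)%R) (gBMO : BMO P F p g) (gb : BMO_norm P F p g < b%:E).
Hypotheses (mf : martingale P F f) (fa : H1_norm P f < a%:E).

Let K : R := (2 * b)%R.
Let b0 : (0 < b)%R := bmo_bound_gt0 gb.
Let K0 : (0 < K)%R. Proof. by rewrite mulr_gt0. Qed.
Let mg : martingale P F g := bmo_martingale gBMO.
Let gK n A : F n A -> \int[P]_(x in A) `|flim g x - lag g n x|%:E <= K%:E * P A.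
Proof. exact: (bmo_integral hF p1 gBMO gb). Qed.
Let lagK n : {ae P, forall x, (`|lag g n x| <= n%:R * K)%R}.
Proof. exact: (bmo_lag_mdiff hF p1 gBMO gb n).1. Qed.
Let mdiffK n : {ae P, forall x, (`|mdiff n g x| <= K)%R}.
Proof. exact: (bmo_lag_mdiff hF p1 gBMO gb n).2. Qed.
Let ig := integrable_flim p1 gBMO.
Let gc := bmo_is_cexp gBMO.
Let af : adapted F f := martingale_adapted mf.
Let ag : adapted F g := martingale_adapted mg.
Let a0 : (0 < a)%R.
Proof. by rewrite -lte_fin; apply: le_lt_trans fa; exact: H1_norm_ge0. Qed.

Let mdf n : measurable_fun [set: T] (mdiff n f) := mdiff_measurable hF af n.
Let mdg n : measurable_fun [set: T] (mdiff n g) := mdiff_measurable hF ag n.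
Let mlf n : measurable_fun [set: T] (lag f n) := lag_measurable hF af n.
Let mlg n : measurable_fun [set: T] (lag g n) := lag_measurable hF ag n.

Let mS n : measurable_fun [set: T] (sqpart f n).
Proof. exact: (measurable_fun_filtration hF (@sqpart_adapted _ _ _ _ hF f af n)). Qed.

Let msq : measurable_fun [set: T] (sqfun f).
Proof. exact: measurable_sqfun. Qed.

Let sqfun_a : \int[P]_x sqfun f x <= a%:E.
Proof. by rewrite -H1_normE ltW. Qed.

Lemma integral_sqpart_le N : \int[P]_x (sqpart f N x)%:E <= a%:E.
Proof.
apply: le_trans sqfun_a; apply: ge0_le_integral => //.
- by move=> x _; rewrite lee_fin sqpart_ge0.
- exact/measurable_EFinP.
- by move=> x _; exact: sqpart_le_sqfun.
Qed.

Lemma diag_part_adapted : adapted F (diag_part f g).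
Proof.
move=> n; apply: measurable_fun_sumr => k kn; apply: measurable_funM.
  exact: (mdiff_adapted hF af).
exact: (mdiff_adapted hF ag).
Qed.

(** The initial value is the term of index 0 in the series of |d_n f d_n g|, so the whole norm is
    one series, bounded at each finite stage by Fefferman's inequality with K = 2b. *)
Lemma diag_part_BV_norm : BV_norm P (diag_part f g) <= (2 ^+ 13 * a * b)%:E.
Proof.
pose u n x : \bar R := (`|mdiff n f x * mdiff n g x|)%:E.
have u0 n x : 0 <= u n x by rewrite lee_fin.
have mu n : measurable_fun [set: T] (u n).
  by apply/measurable_EFinP; apply: measurableT_comp => //; exact: measurable_funM.
rewrite /BV_norm (_ : \int[P]_x _ = \int[P]_x (\sum_(0 <= n <oo) u n x)); last first.
  apply: eq_integral => x _; rewrite nneseries_recl//; congr (_ + _).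
    by rewrite /u -mdiff_diag_part /mdiff /= subr0.
  rewrite /total_var; apply: congr_lim; apply/funext => n.
  apply: eq_big_nat => -[//|k] _.
  by rewrite /u -mdiff_diag_part.
rewrite integral_nneseries//.
apply: lime_le.
  by apply: is_cvg_nneseries => n _ _; exact: integral_ge0.
apply: nearW => -[|n].
  by rewrite big_geq// lee_fin !mulr_ge0 ?exprn_ge0// ltW.
rewrite -ge0_integral_sum//.
under eq_integral do rewrite sumEFin.
apply: (le_trans (fefferman_inequality hF mg ig gc K0 gK lagK mdiffK mf n)).
have c0 : 0 <= (2 ^+ 12 * K)%:E by rewrite lee_fin mulr_ge0 ?exprn_ge0// ltW.
apply: (le_trans (lee_wpmul2l c0 (integral_sqpart_le n))).
rewrite -EFinM lee_fin /K exprS le_eqVlt; apply/orP; left; apply/eqP; ring.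
Qed.

Lemma diag_part_BV : BV P F (diag_part f g).
Proof.
split; first exact: diag_part_adapted.
apply: (@le_lt_trans _ _ (2 ^+ 13 * a * b)%:E); last exact: ltry.
apply: le_trans diag_part_BV_norm; rewrite /BV_norm.
apply: ge0_le_integral_nomeas => x; first exact: nneseries_ge0.
by rewrite leeDr.
Qed.

(** For each fixed n both d_n g and g_{n-1} are almost surely bounded, so the two products forming
    the increment are integrable; each is then a past-measurable factor times a martingale
    difference. *)
Lemma para_part_martingale : martingale P F (para_part f g).
Proof.
have ap : adapted F (para_part f g).
  move=> n; apply: measurable_funB; last exact: (@diag_part_adapted n).
  by apply: measurable_funM; [exact: (@af n)|exact: (@ag n)].
have i1 n : P.-integrable [set: T] (fun x => (lag f n x * mdiff n g x)%:E).
  under eq_fun do rewrite mulrC.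
  apply: (ae_bounded_integrableM _ (mdiffK n)) => //.
  exact: integrable_lag mf _.
have i2 n : P.-integrable [set: T] (fun x => (lag g n x * mdiff n f x)%:E).
  apply: (ae_bounded_integrableM _ (lagK n)) => //.
  exact: (integrable_mdiff mf).
have id n : P.-integrable [set: T] (EFin \o mdiff n (para_part f g)).
  rewrite (_ : EFin \o _ = (fun x => (lag f n x * mdiff n g x)%:E + (lag g n x * mdiff n f x)%:E)).
    exact: integrableD.
  by apply/funext => x; rewrite /= mdiff_para_part EFinD.
have ip n : P.-integrable [set: T] (EFin \o para_part f g n).
  elim: n => [|n ih].
    rewrite (_ : EFin \o _ = EFin \o mdiff 0 (para_part f g))//.
    by apply/funext => x; rewrite /mdiff /= subr0.
  rewrite (_ : EFin \o _ = (fun x => (para_part f g n x)%:E + (mdiff n.+1 (para_part f g) x)%:E)).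
    exact: (integrableD measurableT ih (id n.+1)).
  by apply/funext => x; rewrite /= mdiffS -EFinD subrKC.
split=> // n; split; [exact: ap|exact: ip|move=> A FA].
have mA := filtration_measurable hF FA.
have iA (h : T -> \bar R) : P.-integrable [set: T] h -> P.-integrable A h.
  by move=> i; exact: integrableS i.
have mIA : measurable_fun [set: g_sigma_algebraType (F n)] (\1_A : T -> R).
  by apply: measurable_indic; exact: (measurable_sub (filtration_sigma hF n)).
have iI (h : T -> R) : P.-integrable [set: T] (EFin \o h) ->
    P.-integrable [set: T] (fun x => (\1_A x * h x)%:E).
  move=> ih; apply: (@ae_bounded_integrableM _ _ _ _ _ _ 1%R) => //.
  by apply: nearW => x; rewrite indicE; case: (_ \in _); rewrite ?normr1 ?normr0.
have z1 : \int[P]_(x in A) (lag f n.+1 x * mdiff n.+1 g x)%:E = 0.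
  rewrite integral_indicM; under eq_integral do rewrite mulrA.
  apply: (integral_mdiff_weight0 hF mg).
    by apply: measurable_funM => //; exact: (@af n).
  by under eq_fun do rewrite -mulrA; exact: iI (i1 n.+1).
have z2 : \int[P]_(x in A) (lag g n.+1 x * mdiff n.+1 f x)%:E = 0.
  rewrite integral_indicM; under eq_integral do rewrite mulrA.
  apply: (integral_mdiff_weight0 hF mf).
    by apply: measurable_funM => //; exact: (@ag n).
  by under eq_fun do rewrite -mulrA; exact: iI (i2 n.+1).
rewrite [RHS](_ : _ = \int[P]_(x in A) ((para_part f g n x)%:E +
   ((lag f n.+1 x * mdiff n.+1 g x)%:E + (lag g n.+1 x * mdiff n.+1 f x)%:E))); last first.
  by apply: eq_integral => x _; rewrite -!EFinD -mdiff_para_part mdiffS subrKC.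
rewrite integralD//; [|exact: iA (ip n)|exact: iA (integrableD measurableT (i1 n.+1) (i2 n.+1))].
rewrite integralD//; [|exact: iA (i1 n.+1)|exact: iA (i2 n.+1)].
by rewrite z1 z2 !adde0.
Qed.

(** It is nondecreasing in [n]: its limit [U] dominates all truncations at once, and monotone
    convergence bounds the integral of [U]. *)
Definition para_bound n x : R :=
  (K * maxpart f n x +
   K^-1 * (\sum_(0 <= k < n.+1) lag (maxpart f) k x * mdiff k g x ^+ 2))%R.

Let U x : \bar R := limn (fun n => (para_bound n x)%:E).

Let lagM0 k x : (0 <= lag (maxpart f) k x)%R.
Proof. by case: k => //= k; exact: maxpart_ge0. Qed.

Let para_bound_ge0 n x : (0 <= para_bound n x)%R.
Proof.
rewrite addr_ge0// mulr_ge0 ?invr_ge0 ?maxpart_ge0//; do ?exact: ltW.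
by rewrite sumr_ge0// => k _; rewrite mulr_ge0 ?sqr_ge0.
Qed.

Let para_bound_nd x : {homo (fun n => (para_bound n x)%:E) : m n / (m <= n)%N >-> m <= n}.
Proof.
apply: (@homo_leq _ _ (fun y z : \bar R => y <= z)) => [//|m n k|n].
  exact: le_trans.
have Ke : (0 <= K)%R := ltW K0.
have Ki : (0 <= K^-1)%R by rewrite invr_ge0.
rewrite lee_fin lerD//; first exact: ler_wpM2l Ke _ _ (maxpart_nd f x (leqnSn n)).
apply: ler_wpM2l => //; rewrite [leRHS]big_nat_recr//= lerDl mulr_ge0 ?sqr_ge0//.
exact: maxpart_ge0.
Qed.

Let para_bound_cvg x : (fun n => (para_bound n x)%:E) @ \oo --> U x.
Proof.
by apply/cvg_ex; eexists; apply: ereal_nondecreasing_cvgn; exact: para_bound_nd.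
Qed.

Let le_U n x : (para_bound n x)%:E <= U x.
Proof.
rewrite /U (cvg_lim _ (ereal_nondecreasing_cvgn (@para_bound_nd x)))//.
by apply: ereal_sup_ubound; exists n.
Qed.

Let U_ge0 x : 0 <= U x.
Proof. by apply: le_trans (le_U 0 x); rewrite lee_fin. Qed.

Let mpb n : measurable_fun [set: T] (fun x => (para_bound n x)%:E).
Proof.
have aM := @maxpart_adapted _ _ _ _ hF f af.
apply/measurable_EFinP; apply: measurable_funD; apply: measurable_funM => //.
  exact: (adapted_measurable hF aM).
apply: measurable_fun_sumr => k _; apply: measurable_funM; last exact: measurable_funX.
exact: (lag_measurable hF aM).
Qed.

Let mU : measurable_fun [set: T] U.
Proof.
by apply: (emeasurable_fun_cvg (fun n x => (para_bound n x)%:E)) => // x _; exact: para_bound_cvg.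
Qed.

Let integral_U : \int[P]_x U x <= (2 ^+ 18 * a * b)%:E.
Proof.
rewrite /U monotone_convergence//; last by move=> n x _; rewrite lee_fin.
apply: lime_le.
  apply: ereal_nondecreasing_is_cvgn => m n mn; apply: ge0_le_integral_nomeas => x.
    by rewrite lee_fin.
  exact: para_bound_nd.
apply: nearW => n.
apply: (le_trans (paraproduct_weight_bound hF mg ig gc K0 gK lagK mdiffK mf n)).
have c0 : 0 <= (2 ^+ 17 * K)%:E by rewrite lee_fin mulr_ge0 ?exprn_ge0// ltW.
apply: (le_trans (lee_wpmul2l c0 (integral_sqpart_le n))).
rewrite -EFinM lee_fin /K exprS le_eqVlt; apply/orP; left; apply/eqP; ring.
Qed.

(** As [lag g 0] is 0, this weight controls exp(|g_m| / (9K)) for all m at once. *)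
Let W x := jn_weight g K 0 x.

Let W_ge1 x : 1 <= W x.
Proof.
rewrite /W /jn_weight leeDl// nneseries_ge0// => k _ _.
Qed.

Let W_ge0 x : 0 <= W x. Proof. exact: le_trans (W_ge1 x). Qed.

Let mW : measurable_fun [set: T] W.
Proof. exact: (@measurable_jn_weight _ _ _ P F hF g K mg 0%N). Qed.

Let integral_W : \int[P]_x W x <= 5%:E.
Proof.
have FT : F 0%N [set: T].
  by apply: (sub_measurable (filtration_sigma hF 0)); exact: measurableT.
apply: (le_trans (integral_jn_weight hF mg ig gc K0 gK FT)).
by rewrite probability_setT mule1.
Qed.

Let fin_of_mul (c : R) (x : \bar R) : (0 < c)%R -> 0 <= x -> c%:E * x != +oo ->
  x \is a fin_num.
Proof.
move=> c0 x0; apply: contraR; rewrite ge0_fin_numE// -leNgt leye_eq => /eqP ->.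
by rewrite gt0_muley.
Qed.

(** With this scale the three terms of [pointwise_bound] integrate to at most 1/2, 1/4 and 1/4. *)
Let lam : R := (2 ^+ 20 * a * b)%R.
Let lam0 : (0 < lam)%R. Proof. by rewrite !mulr_gt0 ?exprn_gt0. Qed.

Let pointwise_bound x :
  Philog (`|sqfun (para_part f g) x| * (lam^-1)%:E) <=
  (2 / lam)%:E * U x + ((4 * a)^-1)%:E * sqfun f x + (9 / 2 ^+ 12)%:E * W x.
Proof.
have c1 : (0 < 2 / lam)%R by rewrite divr_gt0.
have c2 : (0 < (4 * a)^-1)%R by rewrite invr_gt0 mulr_gt0.
have c3 : (0 < 9 / 2 ^+ 12 :> R)%R by rewrite divr_gt0// exprn_gt0.
have t1 : 0 <= (2 / lam)%:E * U x by rewrite mule_ge0// lee_fin ltW.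
have t2 : 0 <= ((4 * a)^-1)%:E * sqfun f x by rewrite mule_ge0 ?sqfun_ge0// lee_fin ltW.
have t3 : 0 <= (9 / 2 ^+ 12)%:E * W x by rewrite mule_ge0// lee_fin ltW.
(* If the right-hand side is finite, so are [U x], [sqfun f x] and [W x], and the computation moves
   to the reals. *)
set S := _ + _; have [->|Soo] := eqVneq S +oo; first exact: leey.
have Slt : S < +oo by rewrite ltey.
have Ufin : U x \is a fin_num.
  apply: (fin_of_mul c1) => //; rewrite -ltey; apply: le_lt_trans Slt.
  by rewrite /S -addeA leeDl// adde_ge0.
have ffin : sqfun f x \is a fin_num.
  apply: (fin_of_mul c2); rewrite ?sqfun_ge0// -ltey; apply: le_lt_trans Slt.
  by rewrite /S addeAC leeDr// adde_ge0.
have Wfin : W x \is a fin_num.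
  apply: (fin_of_mul c3) => //; rewrite -ltey; apply: le_lt_trans Slt.
  by rewrite /S leeDr// adde_ge0.
rewrite /S -(fineK Ufin) -(fineK ffin) -(fineK Wfin) -!EFinM -!EFinD.
set u := fine (U x); set s := fine (sqfun f x); set w := fine (W x).
have w1 : (1 <= w)%R by rewrite -lee_fin fineK.
have s0 : (0 <= s)%R by rewrite fine_ge0// sqfun_ge0.
have u0 : (0 <= u)%R by rewrite fine_ge0.
(* The choice turns exp(|g_m| / (9K)) <= 2w into |g_m| <= 9Kq, so [y] bounds the maximal function of
   g at this point. *)
pose q := ln (2 * w); have eq : expR q = (2 * w)%R.
  by rewrite lnK// posrE mulr_gt0// (lt_le_trans ltr01).
have q0 : (0 <= q)%R by apply: ln_ge0; lra.
pose y : R := (9 * K * q)%R.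
have y0 : (0 <= y)%R by rewrite !mulr_ge0// ltW.
have gy k : (`|lag g k x| <= y)%R.
  case: k => [|k]; first by rewrite /= normr0.
  have := expR_jn_weight g K0 x (leq0n k); rewrite -/(W x) -(fineK Wfin) -EFinM lee_fin.
  rewrite -/w -eq ler_expR /= subr0 ler_pdivrMr ?mulr_gt0//.
  by rewrite mulrC.
have bnd : sqfun (para_part f g) x <= (u + 2 * (y * s))%:E.
  apply: sqfun_le; first by rewrite addr_ge0// mulr_ge0// mulr_ge0.
  move=> n; apply: (sqpart_para_part_le K0 y0 _ gy).
    by rewrite -lee_fin fineK//; exact: le_U.
  by rewrite -lee_fin fineK//; exact: sqpart_le_sqfun.
have := sqfun_ge0 (para_part f g) x; move: bnd.
case: (sqfun (para_part f g) x) => // r; rewrite !lee_fin => rb r0.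
rewrite -/(philog _) ger0_norm//.
have l0 : (0 <= lam^-1)%R by rewrite invr_ge0 ltW.
apply: (@le_trans _ _ (philog (u / lam + 2 * (y * s) / lam))).
  by apply: philog_nd; rewrite ?mulr_ge0// -mulrDl ler_wpM2r.
have ul0 : (0 <= u / lam)%R by exact: mulr_ge0.
have ys0 : (0 <= y * s)%R by exact: mulr_ge0.
have yl0 : (0 <= 2 * (y * s) / lam)%R by apply: mulr_ge0 => //; exact: mulr_ge0.
apply: (le_trans (philog_max2 ul0 yl0)).
have h1 : (philog (2 * (u / lam)) <= 2 / lam * u)%R.
  by apply: (le_trans (philog_le _)); [exact: mulr_ge0|rewrite mulrA mulrAC].
have h2 : (philog (2 * (2 * (y * s) / lam)) <= (4 * a)^-1 * s + 9 / 2 ^+ 12 * w)%R.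
  (* Only [s] is scaled by [a]. The leftover 9 / 2^14 is the small parameter of [philog_mul_expR];
     together with exp q = 2w it yields the coefficient 9 / 2^12 of [w]. *)
  have -> : (2 * (2 * (y * s) / lam) = s / (8 * a) * (9 / 2 ^+ 14 * q))%R.
    by rewrite /y /lam /K; field; rewrite !gt_eqF.
  apply: (le_trans (philog_mul_expR _ _ _)) => //.
  - by rewrite divr_ge0// mulr_ge0// ltW.
  - by apply/andP; split; lra.
  rewrite eq le_eqVlt; apply/orP; left; apply/eqP.
  by field; rewrite gt_eqF.
by rewrite -addrA; exact: lerD.
Qed.

Lemma para_part_Hlog_norm : Hlog_norm P (para_part f g) <= (2 ^+ 20 * a * b)%:E.
Proof.
rewrite -/lam /Hlog_norm /Llog_norm; apply: ereal_inf_lbound; exists lam => //.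
split; first exact: lam0.
have c1 : (0 <= 2 / lam)%R by rewrite divr_ge0// ltW.
have c2 : (0 <= (4 * a)^-1)%R by rewrite invr_ge0 mulr_ge0// ltW.
have c3 : (0 <= 9 / 2 ^+ 12 :> R)%R by rewrite divr_ge0// exprn_ge0.
have Philog_ge0 (z : \bar R) : 0 <= z -> 0 <= Philog z.
  by case: z => //= r; rewrite !lee_fin => r0; exact: philog_ge0.
apply: (@le_trans _ _ (\int[P]_x ((2 / lam)%:E * U x +
    ((4 * a)^-1)%:E * sqfun f x + (9 / 2 ^+ 12)%:E * W x))).
  apply: ge0_le_integral_nomeas => x; last exact: pointwise_bound.
  by apply: Philog_ge0; rewrite mule_ge0// lee_fin invr_ge0 ltW.
have mU' : measurable_fun [set: T] (fun x => (2 / lam)%:E * U x) by exact: measurable_funeM.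
have mf' : measurable_fun [set: T] (fun x => ((4 * a)^-1)%:E * sqfun f x).
  exact: measurable_funeM.
have mW' : measurable_fun [set: T] (fun x => (9 / 2 ^+ 12)%:E * W x).
  exact: measurable_funeM.
have U' x : 0 <= (2 / lam)%:E * U x by rewrite mule_ge0// lee_fin.
have f' x : 0 <= ((4 * a)^-1)%:E * sqfun f x by rewrite mule_ge0 ?sqfun_ge0// lee_fin.
have W' x : 0 <= (9 / 2 ^+ 12)%:E * W x by rewrite mule_ge0// lee_fin.
rewrite ge0_integralD//; [|by move=> x _; rewrite adde_ge0|exact: emeasurable_funD].
rewrite ge0_integralD//.
rewrite !ge0_integralZl//; last by move=> x _; exact: sqfun_ge0.
have U1 : (2 / lam)%:E * \int[P]_x U x <= (2^-1)%:E.
  apply: (le_trans (lee_wpmul2l _ integral_U)); rewrite ?lee_fin//.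
  rewrite /lam le_eqVlt; apply/orP; left; apply/eqP.
  by field; rewrite !gt_eqF.
have f1 : ((4 * a)^-1)%:E * \int[P]_x sqfun f x <= (4^-1)%:E.
  apply: (le_trans (lee_wpmul2l _ sqfun_a)); rewrite ?lee_fin//.
  rewrite le_eqVlt; apply/orP; left; apply/eqP.
  by field; rewrite !gt_eqF.
have W1 : (9 / 2 ^+ 12)%:E * \int[P]_x W x <= (4^-1)%:E.
  apply: (le_trans (lee_wpmul2l _ integral_W)); rewrite ?lee_fin//.
  lra.
apply: (le_trans (leeD (leeD U1 f1) W1)).
by rewrite -!EFinD lee_fin; lra.
Qed.

End bounds.

Theorem theorem1p1 (d : measure_display) (T : measurableType d) (R : realType)
    (P : probability T R) (F : nat -> set (set T)) :
  measure_is_complete P ->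
  filtration F ->
  <<s \bigcup_n F n >> = d.-measurable ->
  F 0%N = [set set0; [set: T]] ->
  forall p : R, 1 <= p ->
  exists L G : process T R -> process T R -> process T R,
    [/\ bounded_bilinear (H1 P F) (BMO P F p) (BV P F)
          (H1_norm P) (BMO_norm P F p) (BV_norm P) L,
        bounded_bilinear (H1 P F) (BMO P F p) (Hlog P F)
          (H1_norm P) (BMO_norm P F p) (Hlog_norm P) G,
        forall f g, H1 P F f -> BMO P F p g ->
          forall n x, f n x * g n x = L f g n x + G f g n x &
        forall f g, H1 P F f -> BMO P F p g ->
          forall n x,
            L f g n x = \sum_(0 <= k < n.+1) mdiff k f x * mdiff k g x].
Proof.
move=> _ hF _ _ p p1; exists (@diag_part d T R), (@para_part d T R).
(* Membership in the target spaces needs only some reals above the norms; the norm inequalities use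
   all such reals, through [le_muleM_of_lt]. *)
have above (N : \bar R) : (0 <= N)%E -> (N < +oo)%E -> exists a : R, (N < a%:E)%E.
  by case: N => // r _ _; exists (r + 1); rewrite lte_fin ltrDl.
split.
- split=> [f g [mf fy] [Lg gy]|||].
  + have [a fa] := above _ (H1_norm_ge0 P f) fy.
    have [b gb] := above _ (BMO_norm_ge0 P F p g) gy.
    exact: (diag_part_BV hF p1 (conj Lg gy) gb mf fa).
  + by move=> a f f' g _ _ _; exact: diag_part_linearl.
  + by move=> a f g g' _ _ _; exact: diag_part_linearr.
  + exists (2 ^+ 13) => f g [mf fy] gBMO; have [_ gy] := gBMO.
    apply: le_muleM_of_lt => //.
    * exact: H1_norm_ge0.
    * exact: BMO_norm_ge0.
    * by move=> a b fa gb; exact: (diag_part_BV_norm hF p1 gBMO gb mf fa).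
- split=> [f g [mf fy] [Lg gy]|||].
  + have [a fa] := above _ (H1_norm_ge0 P f) fy.
    have [b gb] := above _ (BMO_norm_ge0 P F p g) gy.
    split; first exact: (para_part_martingale hF p1 (conj Lg gy) gb mf).
    apply: le_lt_trans (para_part_Hlog_norm hF p1 (conj Lg gy) gb mf fa) _.
    exact: ltry.
  + by move=> a f f' g _ _ _; exact: para_part_linearl.
  + by move=> a f g g' _ _ _; exact: para_part_linearr.
  + exists (2 ^+ 20) => f g [mf fy] gBMO; have [_ gy] := gBMO.
    apply: le_muleM_of_lt => //.
    * exact: H1_norm_ge0.
    * exact: BMO_norm_ge0.
    * by move=> a b fa gb; exact: (para_part_Hlog_norm hF p1 gBMO gb mf fa).
- by move=> f g _ _ n x; rewrite /para_part addrC subrK.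
- by [].
Qed.
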